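(* Let $l\ge 2$ and $e\ge 2$ be integers and $\mathbf s\in\mathbb Z^l$. Let $i\neq j$ in $\{1,\dots,l\}$ and $N\in\mathbb Z$, and let $\mathbf m,\mathbf m'\in\mathbb Q^l\setminus\mathfrak M^{\mathbf s,e}$ be separated by the wall $\mathfrak m^{\mathbf s,e}_{i,j,N}$ and by no other wall $\mathfrak m^{\mathbf s,e}_{i',j',N'}$, with $$s_i-m_i-(s_j-m_j)>Ne\quad\text{and}\quad s_i-m'_i-(s_j-m'_j)<Ne .$$ Consider the map on $l$-partitions $(\lambda^1,\dots,\lambda^l)\mapsto(\mu^1,\dots,\mu^l)$ given by $\mu^k=\lambda^k$ for $k\ne i,j$ and $$(\mu^i,\mu^j)=\big(\Phi^\infty_{(s_i-Ne,\;s_j)}\big)^{-1}(\lambda^i,\lambda^j).$$ Then this map is a $\mathfrak g_e$-crystal isomorphism from $\mathcal G_{e,\mathbf m,\mathbf s}$ to $\mathcal G_{e,\mathbf m',\mathbf s}$.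
   Context: **Multipartitions.** An $l$-partition of rank $n$ is an $l$-tuple $\boldsymbol\lambda=(\lambda^1,\dots,\lambda^l)$ of partitions of total size $n$; $\Pi^l(n)$ denotes the set of these. Its nodes are triples $(a,b,c)$ ($a$ row, $b$ column, $c$ component, $1\le b\le\lambda^c_a$). A node of $\boldsymbol\lambda$ is removable if deleting it leaves an $l$-partition; a triple not in $\boldsymbol\lambda$ is addable if adding it gives an $l$-partition. **Walls.** $\mathfrak m^{\mathbf s,e}_{i,j,N}=\{(m_1,\dots,m_l): s_i-m_i-(s_j-m_j)=Ne\}$ for $i\ne j$, $N\in\mathbb Z$ (so $\mathfrak m^{\mathbf s,e}_{i,j,N}=\mathfrak m^{\mathbf s,e}_{j,i,-N}$ is one wall), and $\mathfrak M^{\mathbf s,e}$ is the union of all these walls. **The crystal $\mathcal G_{e,\mathbf m,\mathbf s}$** ($\mathbf m\in\mathbb Q^l\setminus\mathfrak M^{\mathbf s,e}$). The residue of a node $(a,b,c)$ is $b-a+s_c \bmod e\in\mathbb Z/e\mathbb Z$. Two addable or removable nodes $\gamma=(a,b,c)$, $\gamma'=(a',b',c')$ of the same $l$-partition with the same residue are ordered by $\gamma\prec_{\mathbf m}\gamma'$ iff $b-a+m_c<b'-a'+m_{c'}$; this is a total order. The vertices of $\mathcal G_{e,\mathbf m,\mathbf s}$ are all $l$-partitions (of all ranks). For $z\in\mathbb Z/e\mathbb Z$, write the addable and removable nodes of residue $z$ of $\boldsymbol\lambda$ in increasing order, encode addable ones by $A$ and removable ones by $R$, and delete subwords $RA$ recursively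 until a word $A^pR^q$ remains. There is an arrow $\boldsymbol\lambda\xrightarrow{z}\boldsymbol\mu$ iff $p>0$ and $\boldsymbol\mu$ is obtained from $\boldsymbol\lambda$ by adding the node corresponding to the rightmost remaining $A$. (Equivalently, $\boldsymbol\lambda$ is obtained from $\boldsymbol\mu$ by removing the node of the leftmost remaining $R$ in the reduced word of $\boldsymbol\mu$.) A highest weight vertex is one with no incoming arrow. This is a crystal graph of the quantum affine algebra $\mathfrak g_e=\mathcal U_q(\widehat{\mathfrak{sl}_e})$. **Crystal isomorphism.** A bijection $\Psi$ on $l$-partitions, mapping $\Pi^l(n)$ to $\Pi^l(n)$ for each $n$, such that $\boldsymbol\lambda$ is a highest weight vertex of the first graph iff $\Psi(\boldsymbol\lambda)$ is one of the second, and $\boldsymbol\lambda\xrightarrow{z}\boldsymbol\mu$ in the first graph iff $\Psi(\boldsymbol\lambda)\xrightarrow{z}\Psi(\boldsymbol\mu)$ in the second. **The map $\Phi^\infty_{(t_1,t_2)}$.** Let $t_1,t_2\in\mathbb Z$ and let $(\lambda^1,\lambda^2)$ be a bipartition. Let $d\ge|t_1-t_2|$ be minimal with $\lambda^1_{d+1-|t_1-t_2|}=\lambda^2_{d+1-|t_1-t_2|}=0$. For $k=1,2$ let $L_k=\{t_k-q+1+\lambda^k_q : 1\le q\le d+1+t_k-\max(t_1,t_2)\}$. If $t_2\ge t_1$: let $x_1=\min L_1$, and let $y_1=\max\{z\in L_2: z\le x_1\}$ if this set is nonempty, $y_1=\max L_2$ otherwise. Repeat with $L_1\setminus\{x_1\}$,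 $L_2\setminus\{y_1\}$ until the first set is exhausted. Let $Y$ be the set of all $y$'s obtained, $\widetilde L_1=Y$ and $\widetilde L_2=(L_2\setminus Y)\cup L_1$. If $t_2<t_1$: let $x_1=\min L_2$, and let $y_1=\min\{z\in L_1: z\ge x_1\}$ if this set is nonempty, $y_1=\min L_1$ otherwise. Repeat with $L_2\setminus\{x_1\}$, $L_1\setminus\{y_1\}$ until the first set is exhausted. Let $Y$ be the set of all $y$'s obtained, $\widetilde L_2=Y$ and $\widetilde L_1=(L_1\setminus Y)\cup L_2$. Then $\Phi^\infty_{(t_1,t_2)}(\lambda^1,\lambda^2)=(\widetilde\lambda^1,\widetilde\lambda^2)$, where $\widetilde\lambda^k_q$ is the $q$-th largest element of $\widetilde L_k$ minus $(t_k-q+1)$ (and $0$ for larger $q$). It is a rank preserving bijection on bipartitions. *)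

(* Defs.v *)
From HB Require Import structures.
From mathcomp Require Import all_boot all_order all_algebra.
From mathcomp Require Import boolp classical_sets functions.

Set Implicit Arguments.
Unset Strict Implicit.
Unset Printing Implicit Defensive.

Import Order.TTheory GRing.Theory Num.Theory.
Local Open Scope classical_set_scope.
Local Open Scope ring_scope.

(* An integer partition is the list of its nonzero parts in weakly decreasing
   order. Rows are numbered from 0: the part written lambda_q on paper (q >= 1)
   is nth 0 la q.-1, and nth returns 0 past the end, as required. *)
Record intpart := IntPart {
  parts :> seq nat;
  partsP : sorted geq parts && (0%N \notin parts) }.
HB.instance Definition _ := [isSub for parts].
HB.instance Definition _ := [Countable of intpart by <:].

Lemma intpart_of_seq_subproof (s : seq nat) :
  sorted geq (sort geq [seq x <- s | x != 0%N])
  && (0%N \notin sort geq [seq x <- s | x != 0%N]).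
Proof.
rewrite sort_sorted; last by move=> x y; exact: leq_total.
by rewrite mem_sort mem_filter.
Qed.

Definition intpart_of_seq (s : seq nat) : intpart :=
  IntPart (intpart_of_seq_subproof s).

Definition bipartition : Type := intpart * intpart.

Section Multipartitions.
Variable l : nat.

Definition multipartition : Type := {ffun 'I_l -> intpart}.

Definition rank (la : multipartition) : nat := (\sum_(c < l) sumn (la c))%N.

(* (row, column, component); rows and columns are numbered from 0, which leaves
   column - row, the only quantity used below, unchanged. *)
Definition node : Type := nat * nat * 'I_l.

Definition node_row (g : node) : nat := g.1.1.
Definition node_col (g : node) : nat := g.1.2.
Definition node_comp (g : node) : 'I_l := g.2.

Definition in_diagram (la : multipartition) (g : node) : bool :=
  (node_col g < nth 0 (la (node_comp g)) (node_row g))%N.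

Definition adds_node (la : multipartition) (g : node) (mu : multipartition) :
    Prop :=
  ~~ in_diagram la g /\
  forall g', in_diagram mu g' = (g' == g) || in_diagram la g'.

Definition addable (la : multipartition) (g : node) : Prop :=
  exists mu, adds_node la g mu.

Definition removable (la : multipartition) (g : node) : Prop :=
  exists mu, adds_node mu g la.

End Multipartitions.

Section Walls.
Variables (l : nat) (s : {ffun 'I_l -> int}) (e : nat).

Definition wall_form (m : {ffun 'I_l -> rat}) (i j : 'I_l) : rat :=
  (s i)%:~R - m i - ((s j)%:~R - m j).

Definition wall_level (N : int) : rat := (N * e%:Z)%:~R.

Definition wall (i j : 'I_l) (N : int) : set {ffun 'I_l -> rat} :=
  [set m | wall_form m i j = wall_level N].

Definition walls : set {ffun 'I_l -> rat} :=
  [set m | exists i j N, i != j /\ wall i j N m].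

Definition separated_by (i j : 'I_l) (N : int) (m m' : {ffun 'I_l -> rat}) :
    Prop :=
  (wall_form m i j < wall_level N < wall_form m' i j) \/
  (wall_form m' i j < wall_level N < wall_form m i j).

End Walls.

(* Words in the letters A (addable) and R (removable); each letter carries the
   node it stands for, with tag true for A and false for R. *)
Definition word (l : nat) : Type := seq (bool * node l).

Definition letterA (l : nat) (g : node l) : bool * node l := (true, g).
Definition letterR (l : nat) (g : node l) : bool * node l := (false, g).

(* w reduces to w' by successive deletions of factors RA. *)
Inductive deletes_RA (l : nat) : word l -> word l -> Prop :=
| deletes_refl w : deletes_RA w w
| deletes_step u g h v w' :
    deletes_RA (u ++ v) w' ->
    deletes_RA (u ++ [:: letterR g, letterA h & v]) w'.

Section Crystal.
Variables (l e : nat).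

Definition crystal_graph : Type :=
  multipartition l -> 'Z_e -> multipartition l -> Prop.

Definition residue (s : {ffun 'I_l -> int}) (g : node l) : 'Z_e :=
  ((node_col g)%:Z - (node_row g)%:Z + s (node_comp g))%:~R.

Definition node_lt (m : {ffun 'I_l -> rat}) (g g' : node l) : bool :=
  ((node_col g)%:Z - (node_row g)%:Z)%:~R + m (node_comp g) <
  ((node_col g')%:Z - (node_row g')%:Z)%:~R + m (node_comp g').

(* w lists the addable and removable z-nodes of la in increasing order; for m
   outside the walls there is exactly one such w. *)
Definition signature (m : {ffun 'I_l -> rat}) (s : {ffun 'I_l -> int})
    (z : 'Z_e) (la : multipartition l) (w : word l) : Prop :=
  [/\ sorted (fun x y => node_lt m x.2 y.2) w,
      (forall g, letterA g \in w <-> addable la g /\ residue s g = z) &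
      (forall g, letterR g \in w <-> removable la g /\ residue s g = z)].

(* The reduced word is A^p R^q with p > 0, and g is the node of its last A. *)
Definition crystal (m : {ffun 'I_l -> rat}) (s : {ffun 'I_l -> int}) :
    crystal_graph :=
  fun la z mu => exists w (As Rs : seq (node l)) g,
    [/\ signature m s z la w,
        deletes_RA w (map (@letterA l) (rcons As g) ++ map (@letterR l) Rs) &
        adds_node la g mu].

Definition highest_weight (G : crystal_graph) (la : multipartition l) : Prop :=
  forall z mu, ~ G mu z la.

Definition crystal_isomorphism (G G' : crystal_graph)
    (Psi : multipartition l -> multipartition l) : Prop :=
  [/\ bijective Psi,
      forall la, rank (Psi la) = rank la,
      forall la, highest_weight G la <-> highest_weight G' (Psi la) &
      forall la z mu, G la z mu <-> G' (Psi la) z (Psi mu)].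

End Crystal.

Section PhiInfinity.
Variables (t1 t2 : int).

Lemma depth_exists (la1 la2 : seq nat) : exists d,
  let D := absz (t1 - t2)%R in
  [&& (D <= d)%N, nth 0%N la1 (d - D) == 0%N & nth 0%N la2 (d - D) == 0%N].
Proof.
exists (absz (t1 - t2)%R + maxn (size la1) (size la2))%N => /=.
by rewrite leq_addr addKn !nth_default ?eqxx ?leq_maxl ?leq_maxr.
Qed.

Definition depth (la : bipartition) : nat := ex_minn (depth_exists la.1 la.2).

(* L_k is beta_set t_k d la^k, listed in strictly decreasing order. *)
Definition beta_set (t : int) (d : nat) (la : intpart) : seq int :=
  [seq t - q%:Z + (nth 0%N la q)%:Z
     | q <- iota 0 (absz (d%:Z + 1 + t - Num.max t1 t2)%R)].

(* Inverse operation. For the sets L produced by Phi below, the integers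
   x_q - (t - q) form a weakly decreasing sequence of naturals, so that neither
   the absolute value nor the sorting in intpart_of_seq has any effect. *)
Definition intpart_of_beta (t : int) (L : seq int) : intpart :=
  let L' := sort >=%R L in
  intpart_of_seq [seq absz (nth 0 L' q - (t - q%:Z))%R | q <- iota 0 (size L)].

Definition seq_max (L : seq int) : int := last 0 (sort <=%R L).
Definition seq_min (L : seq int) : int := head 0 (sort <=%R L).

Definition pick_below (x : int) (L : seq int) : int :=
  let S := [seq z <- L | z <= x] in
  if S is [::] then seq_max L else seq_max S.

Definition pick_above (x : int) (L : seq int) : int :=
  let S := [seq z <- L | x <= z] in
  if S is [::] then seq_min L else seq_min S.

Fixpoint picked (pick : int -> seq int -> int) (X L : seq int) : seq int :=
  if X is x :: X' then
    let y := pick x L in y :: picked pick X' (rem y L)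
  else [::].

Definition Phi (la : bipartition) : bipartition :=
  let d := depth la in
  let L1 := beta_set t1 d la.1 in
  let L2 := beta_set t2 d la.2 in
  if t1 <= t2 then
    let Y := picked pick_below (sort <=%R L1) L2 in
    (intpart_of_beta t1 Y,
     intpart_of_beta t2 ([seq z <- L2 | z \notin Y] ++ L1))
  else
    let Y := picked pick_above (sort <=%R L2) L1 in
    (intpart_of_beta t1 ([seq z <- L1 | z \notin Y] ++ L2),
     intpart_of_beta t2 Y).

(* The inverse map of Phi (a bijection); the default function id is used only
   on bipartitions outside the range of Phi, of which there are none. *)
Definition Phi_inv : bipartition -> bipartition :=
  'pinv_id [set: bipartition] Phi.

End PhiInfinity.

Definition wall_crossing (l e : nat) (s : {ffun 'I_l -> int}) (i j : 'I_l)
    (N : int) (la : multipartition l) : multipartition l :=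
  let nu := Phi_inv (s i - N * e%:Z) (s j) (la i, la j) in
  [ffun k => if k == i then nu.1 else if k == j then nu.2 else la k].

(* Main.v *)
(* Encode (la^1, la^2), with charges (t1, t2), by its two sets of beads
   t - q + la_q, and write "(" at the integers x that are beads of la^2 only and
   ")" at those that are beads of la^1 only. Phi is the sl_2-reflection of this
   bracket word (matched brackets are left alone and ")^k (^m" becomes
   ")^m (^k") followed by the exchange of the two sets. The crystal operator at
   charged content x acts on the bead pairs at x and x + 1: it moves one bracket
   past an empty or a full position, or creates or erases a matched pair "()".
   Hence it commutes with Phi, the order of the two components being reversed.
   Crossing the wall only exchanges, in the order on nodes of a given residue,
   the adjacent nodes of i and j that have equal charged contents for the
   charges (s_i - N e, s_j). As Phi preserves the reduced word of each such
   block, the signature rule selects the block of the same charged content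
   before and after the crossing, and within it Phi carries one arrow to the
   other. *)
Require Import Defs.
From HB Require Import structures.
From mathcomp Require Import all_boot all_order all_algebra.
From mathcomp Require Import boolp classical_sets functions.
From mathcomp Require Import zify ring lra.

Set Implicit Arguments.
Unset Strict Implicit.
Unset Printing Implicit Defensive.

Import Order.TTheory GRing.Theory Num.Theory.
Local Open Scope ring_scope.

(** * Partitions and beads *)

(** No bracket matching is ever computed. [Phi] is replaced by the relation [linked]: a nonnegative
    walk [E], with the same value at both ends, records the running difference between the new and
    the old first component. The greedy choices of [Phi] supply such a walk, and a given pair is
    linked to at most one other. The relation is symmetric once components and charges are
    exchanged. Bijectivity, the inverse and the commutation with bead moves thus all reduce to
    exhibiting a walk, and a bead move alters it at a single integer. The other obstacle is that the
    signature words before and after the crossing have different letters. They are compared through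
    partial sums over a common finite set of positions, each counted with sign 1, -1 or 0. The last
    remaining [A] sits where these sums first reach their maximum, and a block influences that
    maximum only through its total and its largest prefix sum. *)

Lemma sorted_geq_nth (s : seq nat) a b :
  sorted geq s -> (a <= b)%N -> (nth 0 s b <= nth 0 s a)%N.
Proof.
move=> ss ab; have [bs|bs] := ltnP b (size s); last by rewrite nth_default.
have tr : transitive geq by move=> x y z /= h1 h2; exact: leq_trans h2 h1.
apply: (sorted_leq_nth tr (fun x => leqnn x) 0%N ss) => //.
by rewrite inE (leq_ltn_trans ab).
Qed.

Lemma nth_intpart_of_seq (s : seq nat) a :
  sorted geq s -> nth 0%N (intpart_of_seq s) a = nth 0%N s a.
Proof.
move=> ss /=.
have tr : transitive geq by move=> x y z /= h1 h2; exact: leq_trans h2 h1.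
rewrite sorted_sort //; last exact: sorted_filter.
elim: s a ss => [|x s IH] a ss //=; have ss' := path_sorted ss.
case: eqP => [x0|_] /=; last by case: a => //= a; exact: IH.
rewrite IH //; case: a => [|a] /=; have := sorted_geq_nth ss (isT : (0 <= _)%N).
  by move=> /(_ 1%N) /=; lia.
move=> h; have := h a.+1; have := h a.+2; rewrite /= x0; lia.
Qed.

Lemma intpart_sorted (p : intpart) : sorted geq p.
Proof. by case/andP: (partsP p). Qed.

Lemma intpart_anti (p : intpart) a b :
  (a <= b)%N -> (nth 0 p b <= nth 0 p a)%N.
Proof. exact/sorted_geq_nth/intpart_sorted. Qed.

Lemma intpart_ext (p p' : intpart) :
  (forall a, nth 0%N p a = nth 0%N p' a) -> p = p'.
Proof.
move=> h; apply: val_inj => /=.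
have sz (q : intpart) a : (a < size q)%N = (nth 0 q a != 0)%N.
  have [aq|aq] := ltnP a (size q); last by rewrite nth_default.
  case/andP: (partsP q) => _ /negP h0; symmetry; apply/eqP => q0; apply: h0.
  by rewrite -q0 mem_nth.
have ss : size p = size p'.
  apply/eqP; rewrite eqn_leq; apply/andP; split; rewrite leqNgt.
    by rewrite sz h -sz ltnn.
  by rewrite sz -h -sz ltnn.
by apply: (@eq_from_nth _ 0%N) => // a _; exact: h.
Qed.

Lemma intpart_of_fun (f : nat -> nat) n :
  (forall a b, (a <= b)%N -> (f b <= f a)%N) -> f n = 0%N ->
  exists p : intpart, forall a, nth 0%N p a = f a.
Proof.
move=> fa fn; exists (intpart_of_seq (mkseq f n)) => a.
rewrite nth_intpart_of_seq.
  have [an|na] := ltnP a n; first by rewrite nth_mkseq.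
  rewrite nth_default ?size_mkseq //; have := fa _ _ na; lia.
apply/(sortedP 0%N) => k; rewrite size_mkseq => kn.
by rewrite !nth_mkseq //; [exact: fa | exact: ltnW].
Qed.

(** Boolean, so that beads can be counted as 0 or 1. The search bound suffices because a row [q]
    past the last part has its bead at [t - q], so that [q = t - x]. *)
Definition bead (t : int) (p : seq nat) (x : int) : bool :=
  has (fun q => x == t - q%:Z + (nth 0%N p q)%:Z)
      (iota 0 (size p + absz (t - x)%R).+1).

Lemma beadP t p x :
  reflect (exists q, x = t - q%:Z + (nth 0%N p q)%:Z) (bead t p x).
Proof.
apply: (iffP hasP) => [[q _ /eqP]|[q ->]]; first by exists q.
exists q => //; rewrite mem_iota /= add0n.
have [qp|qp] := ltnP q (size p); first by lia.
rewrite (nth_default _ qp); lia.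
Qed.

Lemma bead_row t (p : seq nat) q : bead t p (t - q%:Z + (nth 0%N p q)%:Z).
Proof. by apply/beadP; exists q. Qed.

Lemma bead_low t (p : seq nat) x : x + (size p)%:Z <= t -> bead t p x.
Proof.
move=> h; apply/beadP; exists (absz (t - x)%R); rewrite nth_default; lia.
Qed.

Lemma bead_high t (p : intpart) x : t + (nth 0%N p 0)%:Z < x -> ~~ bead t p x.
Proof.
move=> h; apply/beadP => -[q xq]; have := intpart_anti p (leq0n q); lia.
Qed.

Lemma bead_row_inj t (p : intpart) q q' :
  t - q%:Z + (nth 0%N p q)%:Z = t - q'%:Z + (nth 0%N p q')%:Z -> q = q'.
Proof.
by case: (ltngtP q q') => // h; have := intpart_anti p (ltnW h); lia.
Qed.

(** Strong induction on rows: the bead of row [a] of one partition is a bead of the other, and it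
    cannot sit in a row before [a], since those rows already agree. Hence it lies weakly below the
    other bead of row [a], and by symmetry the two coincide. *)
Lemma bead_ext t (p p' : intpart) : bead t p =1 bead t p' -> p = p'.
Proof.
move=> h; apply: intpart_ext => a; elim/ltn_ind: a => a IH.
have half (q q' : intpart) : bead t q =1 bead t q' ->
    (forall n, (n < a)%N -> nth 0%N q n = nth 0%N q' n) ->
    (nth 0 q a <= nth 0 q' a)%N.
  move=> {}h {}IH; have := bead_row t q a; rewrite h => /beadP[b e].
  have [ba|ab] := ltnP b a; last by have := intpart_anti q' ab; lia.
  by move: e; rewrite -IH // => /bead_row_inj ea; rewrite ea ltnn in ba.
apply/eqP; rewrite eqn_leq half //=; apply: half => [x|n na]; first by rewrite h.
by rewrite IH.
Qed.

Definition incr_row (p : seq nat) (a : nat) (p' : seq nat) : Prop :=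
  forall a', nth 0%N p' a' = (nth 0 p a' + (a' == a))%N.

Lemma incr_row_bead t (p p' : intpart) a x : incr_row p a p' ->
  let k := t - a%:Z + (nth 0%N p a)%:Z in
  bead t p' x = (x == k + 1) || (bead t p x && (x != k)).
Proof.
move=> h k; apply/beadP/orP => [[q ->]|[/eqP->|/andP[/beadP[q ->] nk]]].
- rewrite h; case: (q =P a) => [->|qa]; [left|right]; first by rewrite /k; lia.
  by rewrite addn0 bead_row; apply/eqP => /bead_row_inj.
- by exists a; rewrite h eqxx /k; lia.
- exists q; rewrite h; case: (q =P a) => [qa|_]; last by rewrite addn0.
  by move: nk; rewrite qa eqxx.
Qed.

Lemma incr_row_above t (p p' : intpart) a : incr_row p a p' ->
  ~~ bead t p (t - a%:Z + (nth 0%N p a)%:Z + 1).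
Proof.
move=> h; apply/beadP => -[q]; have [aq|qa] := leqP a q.
  by have := intpart_anti p aq; lia.
have := intpart_anti p' (ltnW qa); rewrite !h eqxx.
case: eqP => [e|_]; lia.
Qed.

Lemma incr_row_ex t (p : intpart) a :
  ~~ bead t p (t - a%:Z + (nth 0%N p a)%:Z + 1) ->
  exists p' : intpart, incr_row p a p'.
Proof.
move=> nb; apply: (@intpart_of_fun _ (size p + a.+1)); last first.
  by rewrite nth_default ?leq_addr //; case: eqP => //; lia.
move=> b c bc; have := intpart_anti p bc.
case: (c =P a) => [ca|_]; last lia.
case: (b =P a) => [->|ba]; first by rewrite ca.
subst c; suff : nth 0%N p b <> nth 0%N p a by lia.
(* If an earlier row has the length of row [a], so has row [a.-1], whose bead then lies just above
   that of row [a]. *)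
move=> e; case/beadP: nb; exists a.-1.
have ba' : (b <= a.-1)%N by lia.
have := intpart_anti p ba'; have := intpart_anti p (leq_pred a); lia.
Qed.

Lemma decr_row_ex t (p' : intpart) a :
  ~~ bead t p' (t - a%:Z + (nth 0%N p' a)%:Z - 1) ->
  exists p : intpart, incr_row p a p'.
Proof.
move=> nb.
have lt : (nth 0 p' a.+1 < nth 0 p' a)%N.
  rewrite ltn_neqAle intpart_anti // andbT; apply/eqP => e.
  by case/beadP: nb; exists a.+1; rewrite e; lia.
have [||p hp] := @intpart_of_fun (fun b => (nth 0 p' b - (b == a))%N) (size p').
- move=> b c bc; have := intpart_anti p' bc.
  case: (b =P a) => [ba|_]; last lia.
  case: (c =P a) => [->|ca]; first by rewrite ba.
  subst b.
  have [ca'|ac] := leqP c a; first lia.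
  have := intpart_anti p' ac; lia.
- by rewrite nth_default.
by exists p => b; rewrite hp; case: eqP => [->|_]; lia.
Qed.

(** * Pairs of partitions linked by bracket reflection *)

(** A positive value never falls again and a negative one never rises again. After a rise, which
    starts from a value at least 0, the walk stays strictly above that value, and before it the walk
    was never higher, so the two ends could not agree. Falls are symmetric. *)
Lemma walk_const (g : int -> int) (K c : int) :
  (forall x : int, K <= `|x| -> g x = c) ->
  (forall x : int, g (x - 1) < g x -> 0 <= g (x - 1)) ->
  (forall x : int, g x < g (x - 1) -> g (x - 1) <= 0) ->
  forall x : int, g (x - 1) = g x.
Proof.
move=> gK up down.
have stay_pos (x : int) n : 0 < g x -> g x <= g (x + n%:Z).
  move=> gx; elim: n => [|n IH]; first by rewrite addr0.
  have := down (x + n.+1%:Z); rewrite (_ : x + n.+1%:Z - 1 = x + n%:Z); lia.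
have stay_neg (x : int) n : g x < 0 -> g (x + n%:Z) <= g x.
  move=> gx; elim: n => [|n IH]; first by rewrite addr0.
  have := up (x + n.+1%:Z); rewrite (_ : x + n.+1%:Z - 1 = x + n%:Z); lia.
have ex : forall x : int, exists n m : nat,
    [/\ K <= `|x + n%:Z| & K <= `|x - 1 - m%:Z| ].
  by clear=> x; exists (absz x + absz K)%N, (absz x + absz K)%N; split; lia.
move=> x; have [n [m [/gK gn /gK gm]]] := ex x.
case: (ltgtP (g (x - 1)) (g x)) => // gx; exfalso.
- have gn1 := stay_pos x n; have px := up _ gx.
  suff : g (x - 1 - m%:Z) <= g (x - 1) by lia.
  elim: m {gm} => [|m IH]; first by rewrite subr0.
  have := stay_neg (x - 1 - m.+1%:Z) m.+1; rewrite subrK => sn.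
  have := down (x - 1 - m%:Z).
  have := stay_neg (x - 1 - m%:Z) m; rewrite subrK => sn'.
  rewrite (_ : x - 1 - m%:Z - 1 = x - 1 - m.+1%:Z); lia.
- have gn1 := stay_neg x n; have px := down _ gx.
  suff : g (x - 1) <= g (x - 1 - m%:Z) by lia.
  elim: m {gm} => [|m IH]; first by rewrite subr0.
  have := stay_pos (x - 1 - m.+1%:Z) m.+1; rewrite subrK => sn.
  have := up (x - 1 - m%:Z).
  have := stay_pos (x - 1 - m%:Z) m; rewrite subrK => sn'.
  rewrite (_ : x - 1 - m%:Z - 1 = x - 1 - m.+1%:Z); lia.
Qed.

(** [walk_const] read from right to left: the sign conditions bear on the value after the step. *)
Lemma walk_const_rev (g : int -> int) (K c : int) :
  (forall x : int, K <= `|x| -> g x = c) ->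
  (forall x : int, g x < g (x - 1) -> 0 <= g x) ->
  (forall x : int, g (x - 1) < g x -> g x <= 0) ->
  forall x : int, g (x - 1) = g x.
Proof.
move=> gK down up x.
have := @walk_const (fun x => g (- x)) K c _ _ _ (1 - x).
rewrite (_ : 1 - x - 1 = - x) ?opprK; last lia.
rewrite opprB => h; symmetry; apply: h => {x} x; rewrite ?opprB.
- by move=> Kx; apply: gK; rewrite normrN.
- by have := down (1 - x); rewrite addrAC subrr add0r.
- by have := up (1 - x); rewrite addrAC subrr add0r.
Qed.

(** One constant serves both ends: the walks compare two bead sets of the same charge, whose
    differences sum to 0. *)
Definition eventually_const (E : int -> int) : Prop :=
  exists K c : int, forall x : int, K <= `|x| -> E x = c.

(* At each [x] the pair of beads of [mu] is that of [la] with its entries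
   exchanged, except that it may stay as it is where the walk [E] has its minimum
   (normalized to be [0]); these [x] are the unmatched brackets. *)
Definition linked_by (t1 t2 : int) (la mu : bipartition) (E : int -> int) :
    Prop :=
  [/\ forall x : int, 0 <= E x,
      forall x : int,
        E x = E (x - 1) + (bead t1 mu.1 x)%:Z - (bead t1 la.1 x)%:Z,
      forall x : int, (bead t1 la.1 x + bead t2 la.2 x =
                 bead t1 mu.1 x + bead t2 mu.2 x)%N &
      forall x : int, bead t2 la.2 x != bead t1 mu.1 x ->
        E x = 0 /\ (t1 < t2 /\ bead t2 la.2 x \/ t2 < t1 /\ bead t1 la.1 x)].

Definition linked (t1 t2 : int) (la mu : bipartition) : Prop :=
  exists E : int -> int,
    eventually_const E /\ linked_by t1 t2 la mu E.

(** The same walk serves: since the sums agree at each integer, the gain of the first component is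
    the loss of the second. *)
Lemma linked_flip t1 t2 la1 la2 mu1 mu2 :
  linked t1 t2 (la1, la2) (mu1, mu2) -> linked t2 t1 (mu2, mu1) (la2, la1).
Proof.
move=> [E [EK [/= E0 dE sums exc]]]; exists E; split=> //; split=> //= x.
- have := dE x; have := sums x; lia.
- have := sums x; lia.
- move=> nx; have := sums x; have := exc x; move: nx.
  by do 4!case: (bead _ _ _) => //=; lia.
Qed.

(** The difference of the two walks changes only at an integer where one link keeps the pair and the
    other exchanges it. There the keeping walk is 0 and the other is nonnegative. This gives the
    sign conditions before the step if [t1 <= t2] and after it if [t2 < t1], whence the two versions
    of [walk_const]. *)
Lemma linked_uniq t1 t2 la mu mu' :
  linked t1 t2 la mu -> linked t1 t2 la mu' -> mu = mu'.
Proof.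
case: la mu mu' => [la1 la2] [mu1 mu2] [nu1 nu2].
move=> [E [[K [c EK]] [/= E0 dE sums exc]]].
move=> [E' [[K' [c' EK']] [/= E0' dE' sums' exc']]].
suff g0 (x : int) : E' (x - 1) - E (x - 1) = E' x - E x.
  congr (_, _).
    by apply: (@bead_ext t1) => x; have := g0 x; have := dE x; have := dE' x; lia.
  apply: (@bead_ext t2) => x; have := g0 x; have := dE x; have := dE' x.
  have := sums x; have := sums' x; lia.
have [t12|t21] := leP t1 t2.
- apply: (@walk_const (fun x => E' x - E x) (`|K| + `|K'|) (c' - c)) => {x} x.
    have := EK x; have := EK' x; lia.
  + have := dE x; have := dE' x; have := exc x; have := sums x; have := E0' (x - 1).
    have := exc' x; have := sums' x; have := E0' x; lia.
  + have := dE x; have := dE' x; have := exc x; have := sums x; have := E0 (x - 1).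
    have := exc' x; have := sums' x; have := E0 x; lia.
- apply: (@walk_const_rev (fun x => E' x - E x) (`|K| + `|K'|) (c' - c)) => {x} x.
    have := EK x; have := EK' x; lia.
  + have := dE x; have := dE' x; have := exc x; have := sums x; have := E0 x.
    have := exc' x; have := sums' x; have := E0' x; lia.
  + have := dE x; have := dE' x; have := exc x; have := sums x; have := E0 x.
    have := exc' x; have := sums' x; have := E0' x; lia.
Qed.

(** The letter at charged content [x]: 1 for an addable node, -1 for a removable one, 0 if there is
    neither. *)
Definition sgn (t : int) (p : seq nat) (x : int) : int :=
  (bead t p x)%:Z - (bead t p (x + 1))%:Z.

Definition moves_bead (t : int) (p : seq nat) (x : int) (p' : seq nat) : Prop :=
  [/\ bead t p x, ~~ bead t p (x + 1) &
      forall w, bead t p' w = (w == x + 1) || (bead t p w && (w != x))].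

(** If the two letters at [x] reduce to [A^p R^q], their sum is [p - q] and their largest prefix sum
    is [p]. So this is the invariance of the reduced word, with component 2 read first on the left
    and component 1 read first on the right. *)
Lemma linked_sgn t1 t2 l1 l2 m1 m2 (x : int) :
  linked t1 t2 (l1, l2) (m1, m2) ->
  sgn t1 l1 x + sgn t2 l2 x = sgn t1 m1 x + sgn t2 m2 x /\
  Num.max 0 (Num.max (sgn t2 l2 x) (sgn t1 l1 x + sgn t2 l2 x)) =
  Num.max 0 (Num.max (sgn t1 m1 x) (sgn t1 m1 x + sgn t2 m2 x)).
Proof.
move=> [E [_ [/= E0 dE sums exc]]]; rewrite /sgn.
have := sums x; have := sums (x + 1); have := exc x; have := exc (x + 1).
have := dE x; have := dE (x + 1); rewrite addrK.
have := E0 (x - 1); have := E0 x; have := E0 (x + 1); clear.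
move: (bead t1 l1 x) (bead t1 l1 (x + 1)) (bead t2 l2 x) (bead t2 l2 (x + 1)).
move: (bead t1 m1 x) (bead t1 m1 (x + 1)) (bead t2 m2 x) (bead t2 m2 (x + 1)).
move: (E x) (E (x + 1)) (E (x - 1)) => e1 e2 e0.
by case; case; case; case; case; case; case; case => //=; lia.
Qed.

(** For changes confined to [x] and [x + 1] the walk is replaced by [Ex] at [x] and rejoins its old
    values at [x + 1], so that only these two integers have to be checked. *)
Lemma linked_update t1 t2 (l1 l2 m1 m2 l1' l2' m1' m2' : intpart) (x : int) E :
  eventually_const E ->
  linked_by t1 t2 (l1, l2) (m1, m2) E ->
  (forall w : int, w != x -> w != x + 1 -> [/\ bead t1 l1' w = bead t1 l1 w,
     bead t2 l2' w = bead t2 l2 w, bead t1 m1' w = bead t1 m1 w &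
     bead t2 m2' w = bead t2 m2 w]) ->
  let Ex := E (x - 1) + (bead t1 m1' x)%:Z - (bead t1 l1' x)%:Z in
  0 <= Ex ->
  E (x + 1) = Ex + (bead t1 m1' (x + 1))%:Z - (bead t1 l1' (x + 1))%:Z ->
  (forall w : int, w = x \/ w = x + 1 -> (bead t1 l1' w + bead t2 l2' w =
                 bead t1 m1' w + bead t2 m2' w)%N /\
    (bead t2 l2' w != bead t1 m1' w ->
        (if w == x then Ex else E w) = 0 /\
        (t1 < t2 /\ bead t2 l2' w \/ t2 < t1 /\ bead t1 l1' w))) ->
  linked t1 t2 (l1', l2') (m1', m2').
Proof.
move=> [K [c EK]] [E0 dE sums exc] off Ex Ex0 Ex1 loc.
exists (fun w => if w == x then Ex else E w); split=> /=.
  exists (`|K| + `|x| + 1), c => w Kw; have := EK w.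
  case: (w =P x) => [wx|_]; last by lia.
  by rewrite wx in Kw; lia.
split=> /= w.
- by case: (w =P x) => [_|_]; [exact: Ex0 | exact: E0].
- case: (w =P x) => [->|wx].
    by rewrite (_ : (x - 1 == x) = false) //; apply/eqP; lia.
  case: (w =P x + 1) => [->|wx1]; first by rewrite addrK eqxx.
  rewrite (_ : (w - 1 == x) = false); last by apply/eqP; lia.
  have /eqP nx := wx; have /eqP nx1 := wx1.
  by have [-> _ -> _] := off w nx nx1; exact: dE.
- have [wx|nx] := eqVneq w x; first by case: (loc w (or_introl wx)).
  have [wx|nx1] := eqVneq w (x + 1); first by case: (loc w (or_intror wx)).
  by have [-> -> -> ->] := off w nx nx1.
- have [wx|nx] := eqVneq w x.
    by have [_] := loc w (or_introl wx); rewrite wx eqxx.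
  have [wx|nx1] := eqVneq w (x + 1).
    case: (loc w (or_intror wx)) => _; by rewrite (negbTE nx).
  by have [-> -> -> _] := off w nx nx1; exact: exc.
Qed.

(* The hypothesis is the signature rule for the two letters at [x] when the
   letter of component 2 comes first, the conclusion the rule when the letter of
   component 1 comes first. *)
Lemma sgn_bound t p x : -1 <= sgn t p x <= 1.
Proof. rewrite /sgn; case: bead; case: bead; lia. Qed.

(** [linked_sgn] decides which component of the image moves. [linked_update] then leaves finitely
    many cases in the beads at [x] and [x + 1], constrained by the walk at [x - 1], [x] and
    [x + 1]. *)
Lemma linked_moves t1 t2 (l1 l2 m1 m2 l1' l2' : intpart) (x : int) :
  linked t1 t2 (l1, l2) (m1, m2) ->
  [/\ sgn t2 l2 x = 1, sgn t1 l1 x <= 0, l1' = l1 & moves_bead t2 l2 x l2'] \/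
  [/\ sgn t1 l1 x = 1, 0 <= sgn t2 l2 x, l2' = l2 & moves_bead t1 l1 x l1'] ->
  [/\ sgn t1 m1 x = 1, sgn t2 m2 x <= 0 &
      forall m1' : intpart, moves_bead t1 m1 x m1' ->
        linked t1 t2 (l1', l2') (m1', m2)] \/
  [/\ sgn t2 m2 x = 1, 0 <= sgn t1 m1 x &
      forall m2' : intpart, moves_bead t2 m2 x m2' ->
        linked t1 t2 (l1', l2') (m1, m2')].
Proof.
move=> lkd act; have [S1 S2] := linked_sgn x lkd.
have [E [EK lk]] := lkd; have [/= E0 dE sums exc] := lk.
have x1x : (x + 1 == x) = false by apply/eqP; lia.
have xx1 : (x == x + 1) = false by apply/eqP; lia.
have [off on] : (forall w : int, w != x -> w != x + 1 ->
     bead t1 l1' w = bead t1 l1 w /\ bead t2 l2' w = bead t2 l2 w) /\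
   ([/\ bead t2 l2 x, ~~ bead t2 l2 (x + 1), ~~ bead t2 l2' x, bead t2 l2' (x + 1) &
     sgn t1 l1 x <= 0 /\ l1' = l1] \/
   [/\ bead t1 l1 x, ~~ bead t1 l1 (x + 1), ~~ bead t1 l1' x, bead t1 l1' (x + 1) &
     0 <= sgn t2 l2 x /\ l2' = l2]).
  case: act => -[sa sb -> [b0 b1 mv]]; (split; first by move=> w /negbTE wx /negbTE wx1;
    rewrite mv wx wx1 /= andbT); [left|right];
    by split; rewrite ?mv ?eqxx ?xx1 ?x1x ?andbF.
have case_mu : (sgn t1 m1 x = 1 /\ sgn t2 m2 x <= 0) \/
               (sgn t2 m2 x = 1 /\ 0 <= sgn t1 m1 x).
  have := sgn_bound t1 m1 x; have := sgn_bound t2 m2 x.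
  by case: act => -[? ? _ _]; lia.
have := exc x; have := exc (x + 1); have := sums x; have := sums (x + 1).
have := dE x; have := dE (x + 1); rewrite addrK.
have := E0 (x - 1); have := E0 x; have := E0 (x + 1) => e1 ex e0 d1 dx s1 sx ex1 exx.
case: case_mu => -[A B]; [left|right]; split=> // m' [b0 b1 mv].
all: have mx := mv x; have mx1 := mv (x + 1).
all: rewrite eqxx xx1 andbF /= in mx; rewrite eqxx /= in mx1.
all: apply: (linked_update EK lk (x := x)) => /= [w wx wx1|||w].
all: rewrite ?mx ?mx1.
all: try by have [-> ->] := off w wx wx1; rewrite mv (negbTE wx) (negbTE wx1) /= andbT.
all: case: on => -[b2 b3 b4 b5 [sa ll]]; subst; rewrite /sgn in A B sa.
all: try (case=> ->; rewrite ?eqxx ?x1x ?mx ?mx1).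
all: move: (E x) (E (x + 1)) (E (x - 1)) e1 ex e0 d1 dx s1 sx ex1 exx sa A B.
all: rewrite ?b0 ?(negbTE b1) ?b2 ?(negbTE b3) ?(negbTE b4) ?b5; clear.
all: do 4?[case: bead => //=].
all: lia.
Qed.

(** * The greedy matching defining Phi *)

Lemma seq_maxP (L : seq int) : L != [::] ->
  seq_max L \in L /\ forall z : int, z \in L -> z <= seq_max L.
Proof.
rewrite /seq_max => L0; have := sort_sorted (@ge_total _ int) L.
have := sort_sorted (@le_total _ int) L => ss _.
have ms : sort <=%R L =i L by move=> z; rewrite mem_sort.
have s0 : sort <=%R L != [::] by rewrite -size_eq0 size_sort size_eq0.
move: (sort <=%R L) ss ms s0 => [//|a s] ss ms _ /=; split.
  by rewrite -ms mem_last.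
move=> z; rewrite -ms; elim: s a z ss {ms} => [|b s IH] a z /=.
  by rewrite inE => _ /eqP ->.
case/andP=> ab pb; rewrite inE => /orP[/eqP->|]; last exact: IH.
by apply: le_trans ab _; apply: IH; rewrite ?mem_head.
Qed.

Lemma seq_minP (L : seq int) : L != [::] ->
  seq_min L \in L /\ forall z : int, z \in L -> seq_min L <= z.
Proof.
rewrite /seq_min => L0; have ss := sort_sorted (@le_total _ int) L.
have ms : sort <=%R L =i L by move=> z; rewrite mem_sort.
have s0 : sort <=%R L != [::] by rewrite -size_eq0 size_sort size_eq0.
move: (sort <=%R L) ss ms s0 => [//|a s] /= ss ms _; split.
  by rewrite -ms mem_head.
move=> z; rewrite -ms inE => /orP[/eqP-> //|].
by have /allP := order_path_min le_trans ss; apply.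
Qed.

Lemma pick_belowP x (L : seq int) : L != [::] ->
  pick_below x L \in L /\
  ((pick_below x L <= x /\ forall z : int, z \in L -> z <= x -> z <= pick_below x L) \/
   (x < pick_below x L /\
    forall z : int, z \in L -> x < z /\ z <= pick_below x L)).
Proof.
move=> L0; rewrite /pick_below; case E: [seq z <- L | z <= x] => [|a s].
  have [mL mx] := seq_maxP L0; split=> //; right.
  have gtx z : z \in L -> x < z.
    move=> zL; have : z \notin [seq z <- L | z <= x] by rewrite E.
    by rewrite mem_filter zL andbT -ltNge.
  by split=> [|z zL]; [exact: gtx | split; [exact: gtx | exact: mx]].
have [] := @seq_maxP (a :: s) isT; rewrite -E mem_filter => /andP[le mL] mx.
by split=> //; left; split=> // z zL zx; apply: mx; rewrite mem_filter zx.
Qed.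

Lemma pick_aboveP x (L : seq int) : L != [::] ->
  pick_above x L \in L /\
  ((x <= pick_above x L /\ forall z : int, z \in L -> x <= z -> pick_above x L <= z) \/
   (pick_above x L < x /\
    forall z : int, z \in L -> z < x /\ pick_above x L <= z)).
Proof.
move=> L0; rewrite /pick_above; case E: [seq z <- L | x <= z] => [|a s].
  have [mL mx] := seq_minP L0; split=> //; right.
  have gtx z : z \in L -> z < x.
    move=> zL; have : z \notin [seq z <- L | x <= z] by rewrite E.
    by rewrite mem_filter zL andbT -ltNge.
  by split=> [|z zL]; [exact: gtx | split; [exact: gtx | exact: mx]].
have [] := @seq_minP (a :: s) isT; rewrite -E mem_filter => /andP[le mL] mx.
by split=> //; left; split=> // z zL zx; apply: mx; rewrite mem_filter zx.
Qed.

(* Matching [x] with [pick x L] adds to the walk a bump that vanishes at every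
   other element of [L]. *)
Definition nearest (sg : int) (pick : int -> seq int -> int) : Prop :=
  forall (x : int) L, L != [::] ->
  pick x L \in L /\ exists b : int -> int,
  [/\ eventually_const b, forall w : int, 0 <= b w,
      forall w : int, b w = b (w - 1) +
                 sg * ((w == pick x L)%:Z - (w == x)%:Z) &
      forall u : int, u \in L -> u != pick x L -> u != x /\ b u = 0].

(** A pick [y <= x] gives the bump on [[y, x)]. A pick that wraps around to the maximum gives the
    complement of [[x, y)]: it is 1 at both ends, and 0 at the other elements of [L] because they
    all lie strictly between [x] and [y]. *)
Lemma nearest_below : nearest 1 pick_below.
Proof.
move=> x L L0; have [yL] := pick_belowP x L0.
move: (pick_below x L) yL => y yL h; split=> //.
case: h => -[yx h]; [exists (fun w : int => (y <= w < x)%R%:Z)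
  | exists (fun w : int => 1 - (x <= w < y)%R%:Z)].
all: split=> [|w|w|u uL uy]; try lia.
all: try by exists (`|x| + `|y| + 1); eexists => w hw;
  rewrite (_ : (_ <= w < _) = false); [reflexivity | lia].
- have := h u uL; move: uy; lia.
- have := h u uL; move: uy; lia.
Qed.

Lemma nearest_above : nearest (-1) pick_above.
Proof.
move=> x L L0; have [yL] := pick_aboveP x L0.
move: (pick_above x L) yL => y yL h; split=> //.
case: h => -[yx h]; [exists (fun w : int => (x <= w < y)%R%:Z)
  | exists (fun w : int => 1 - (y <= w < x)%R%:Z)].
all: split=> [|w|w|u uL uy]; try lia.
all: try by exists (`|x| + `|y| + 1); eexists => w hw;
  rewrite (_ : (_ <= w < _) = false); [reflexivity | lia].
- have := h u uL; move: uy; lia.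
- have := h u uL; move: uy; lia.
Qed.

(** The walk is the sum of the bumps of the successive picks. It vanishes at an element that is
    never picked, since that element is still in the list at every stage. *)
Lemma picked_walk sg pick (X L : seq int) : nearest sg pick ->
  uniq X -> uniq L -> (size X <= size L)%N ->
  let Y := picked pick X L in
  [/\ uniq Y, {subset Y <= L}, size Y = size X & exists E : int -> int,
  [/\ eventually_const E, forall w : int, 0 <= E w,
      forall w : int, E w = E (w - 1) + sg * ((w \in Y)%:Z - (w \in X)%:Z) &
      forall u : int, u \in L -> u \notin Y -> u \notin X /\ E u = 0]].
Proof.
move=> near; elim: X L => [|x X IH] L /=.
  move=> _ _ _; split=> //; exists (fun=> 0); split=> // [|w].
    by exists 0, 0.
  by rewrite subrr mulr0 addr0.
case/andP=> xX uX uL sXL.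
have L0 : L != [::] by case: L sXL uL.
have [yL [b [[Kb [cb bK]] b0 db bu]]] := near x L L0.
move: (pick x L) yL db bu => y yL db bu.
have sXL' : (size X <= size (rem y L))%N by rewrite size_rem //; case: (size L) sXL.
have [uY YL sY [E [[K [c EK]] E0 dE Eu]]] := IH (rem y L) uX (rem_uniq _ uL) sXL'.
have yY : y \notin picked pick X (rem y L).
  by apply/negP => /YL; rewrite mem_rem_uniq // inE eqxx.
split; rewrite /= ?yY ?sY //.
  by move=> z; rewrite inE => /orP[/eqP-> //|/YL /mem_rem].
exists (fun w => E w + b w); split.
- exists (`|K| + `|Kb|), (c + cb) => w hw; rewrite EK ?bK //; lia.
- by move=> w; rewrite addr_ge0.
- move=> w; rewrite dE db !in_cons.
  have -> : ((w == y) || (w \in picked pick X (rem y L)))%:Z =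
            (w == y)%:Z + (w \in picked pick X (rem y L))%:Z.
    by case: (w =P y) => [->|_]; rewrite ?(negbTE yY).
  have -> : ((w == x) || (w \in X))%:Z = (w == x)%:Z + (w \in X)%:Z.
    by case: (w =P x) => [->|_]; rewrite ?(negbTE xX).
  rewrite !mulrBr !mulrDr; lia.
- move=> u uL'; rewrite inE negb_or => /andP[uy uY'].
  have [ux bu0] := bu u uL' uy.
  have uL2 : u \in rem y L by rewrite mem_rem_uniq // inE uy.
  by have [uX' ->] := Eu u uL2 uY'; rewrite inE negb_or ux uX' bu0.
Qed.

Definition beads (t : int) (n : nat) (p : seq nat) : seq int :=
  [seq t - q%:Z + (nth 0%N p q)%:Z | q <- iota 0 n].

Lemma beads_uniq t n (p : intpart) : uniq (beads t n p).
Proof. by rewrite map_inj_uniq ?iota_uniq // => q q' /bead_row_inj. Qed.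

Lemma mem_beads t n (p : intpart) x : nth 0%N p n = 0%N ->
  bead t p x = (x \in beads t n p) || (x <= t - n%:Z).
Proof.
move=> pn; apply/beadP/orP => [[q ->]|[/mapP[q _ ->]|xn]]; last 2 first.
- by exists q.
- have nx : (n <= absz (t - x)%R)%N by lia.
  have := intpart_anti p nx; exists (absz (t - x)%R); lia.
have [qn|nq] := ltnP q n; [left|right].
  by apply/mapP; exists q; rewrite ?mem_iota.
have := intpart_anti p nq; lia.
Qed.

Lemma beads_gt t n (p : intpart) x : x \in beads t n p -> t - n%:Z < x.
Proof. by case/mapP => q; rewrite mem_iota /= add0n => qn ->; lia. Qed.

Lemma intpart_of_betaP t (L : seq int) : uniq L ->
  (forall z : int, z \in L -> t - (size L)%:Z < z) ->
  forall x, bead t (intpart_of_beta t L) x =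
            (x \in L) || (x <= t - (size L)%:Z).
Proof.
move=> uL Lgt x; rewrite /intpart_of_beta; set L' := sort _ _; set s := map _ _.
have sz : size L' = size L by rewrite size_sort.
have mL z : (z \in L') = (z \in L) by rewrite mem_sort.
have step q : (q.+1 < size L)%N -> nth 0 L' q.+1 < nth 0 L' q.
  move=> qL; have tot : total (>=%R : rel int) by move=> y z; exact: le_total.
  have /(sortedP 0) /(_ q) := sort_sorted tot L; rewrite -/L' sz => /(_ qL).
  rewrite /= le_eqVlt => /orP[|//]; rewrite nth_uniq ?sz ?(ltnW qL) ?sort_uniq //.
  by rewrite -[X in X == _]addn1 -[X in _ == X]addn0 eqn_add2l.
have mono q k : (q + k < size L)%N ->
    nth 0 L' (q + k)%N + k%:Z <= nth 0 L' q.
  elim: k => [|k IH] qk; first by rewrite addn0 addr0.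
  have := step (q + k)%N; rewrite -addnS => /(_ qk); have := IH (ltn_trans (ltnSn _) _).
  rewrite addnS => /(_ _); lia.
(* Below the entry of index [q] come [(size L).-1 - q] further distinct integers, all greater than
   [t - size L]. *)
have ge q : (q < size L)%N -> t - q%:Z <= nth 0 L' q.
  move=> qL; have := mono q ((size L).-1 - q)%N; rewrite subnKC; last lia.
  have : nth 0 L' (size L).-1 \in L by rewrite -mL mem_nth // sz; lia.
  move/Lgt; lia.
have ns q : (q < size L)%N -> (nth 0%N s q)%:Z = nth 0 L' q - (t - q%:Z).
  move=> qL; rewrite (nth_map 0%N) ?size_iota // nth_iota // add0n.
  have := ge q qL; lia.
have ss : sorted geq s.
  apply/(sortedP 0%N) => q; rewrite size_map size_iota => qL.
  have := ns q (ltnW qL); have := ns q.+1 qL; have := step q qL; rewrite /=; lia.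
have s0 q : (size L <= q)%N -> nth 0%N s q = 0%N.
  by move=> qL; rewrite nth_default // size_map size_iota.
apply/beadP/orP => [[q ->]|].
  rewrite nth_intpart_of_seq //; have [qL|Lq] := ltnP q (size L); [left|right].
    by rewrite ns // addrC subrK -mL mem_nth ?sz.
  by rewrite s0 //; lia.
case=> [|xL].
  rewrite -mL => /(nthP 0)[q]; rewrite sz => qL <-; exists q.
  by rewrite nth_intpart_of_seq // ns // addrC subrK.
exists (absz (t - x)%R); rewrite nth_intpart_of_seq // s0; lia.
Qed.

Lemma size_filter_notin (L Y : seq int) : uniq L -> uniq Y ->
  {subset Y <= L} -> size [seq z <- L | z \notin Y] = (size L - size Y)%N.
Proof.
move=> uL uY YL; have : perm_eq [seq z <- L | z \in Y] Y.
  apply: uniq_perm; rewrite ?filter_uniq // => z; rewrite mem_filter.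
  by case zY: (z \in Y) => //=; apply: YL.
move=> /perm_size <-; by rewrite !size_filter -(count_predC (mem Y) L) addKn.
Qed.

(** Both cases of [Phi] at once: [X] holds the beads of the component of smaller charge, and [sg]
    fixes the direction of the matching. Up to the common cutoff [base] all positions of both
    components are occupied. *)
Lemma picked_walk_bead sg pick t t' base (a a' : intpart) (X L : seq int) :
  nearest sg pick -> uniq X -> uniq L -> t <= t' ->
  t - (size X)%:Z = base -> t' - (size L)%:Z = base ->
  (forall z : int, z \in X -> base < z) ->
  (forall z : int, z \in L -> base < z) ->
  (forall x, bead t a x = (x \in X) || (x <= base)) ->
  (forall x, bead t' a' x = (x \in L) || (x <= base)) ->
  let Y := picked pick (sort <=%R X) L in
  let b := intpart_of_beta t Y in
  let b' := intpart_of_beta t' ([seq z <- L | z \notin Y] ++ X) in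
  exists E, [/\ eventually_const E, forall w : int, 0 <= E w,
    forall w : int,
      E w = E (w - 1) + sg * ((bead t b w)%:Z - (bead t a w)%:Z),
    forall w, (bead t a w + bead t' a' w = bead t b w + bead t' b' w)%N &
    forall w, bead t' a' w != bead t b w ->
      [/\ E w = 0, t < t' & bead t' a' w]].
Proof.
move=> near uX uL tt' sX sL gX gL bX bL Y b b'.
have sXL : (size X <= size L)%N by lia.
have uX' : uniq (sort <=%R X) by rewrite sort_uniq.
have sXL' : (size (sort <=%R X) <= size L)%N by rewrite size_sort.
have [uY YL sY [E [EK E0 dE exc]]] := picked_walk near uX' uL sXL'.
rewrite -/Y in uY YL sY dE exc *; rewrite size_sort in sY.
have mX z : (z \in sort <=%R X) = (z \in X) by rewrite mem_sort.
have uZ : uniq ([seq z <- L | z \notin Y] ++ X).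
  rewrite cat_uniq filter_uniq // uX andbT; apply/hasPn => z zX.
  rewrite mem_filter; apply/negP => /andP[zY zL].
  by have [/negP] := exc z zL zY; rewrite mX.
have sZ : size ([seq z <- L | z \notin Y] ++ X) = size L.
  by rewrite size_cat size_filter_notin // sY subnK.
have bY : forall x, bead t b x = (x \in Y) || (x <= base).
  by rewrite -sX -sY; apply: intpart_of_betaP => // z /YL /gL; rewrite sY sX.
have bZ : forall x, bead t' b' x =
    (x \in [seq z <- L | z \notin Y] ++ X) || (x <= base).
  rewrite -{1}sL -sZ; apply: intpart_of_betaP => // z.
  by rewrite sZ sL mem_cat mem_filter => /orP[/andP[_]|]; [exact: gL|exact: gX].
clearbody b b' Y; exists E; split=> // w.
- rewrite dE bX bY mX; congr (_ + _ * _).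
  have := gX w; have := gL w; have := YL w; clear.
  by case: (w \in Y); case: (w \in X); case: (w \in L) => /=; lia.
- rewrite bX bY bL bZ mem_cat mem_filter.
  have := gX w; have := gL w; have := YL w; have := exc w; rewrite mX; clear.
  by case: (w \in Y); case: (w \in X); case: (w \in L) => //=; lia.
- rewrite bL bY; case: (boolP (w \in Y)) => wY.
    by rewrite (YL w wY).
  case: (boolP (w \in L)) => wL /=; last by rewrite eqxx.
  have [_ ->] := exc w wL wY; split=> //.
  (* An unpicked element makes [L] longer than [X], that is, [t < t']. *)
  suff : (0 < size [seq z <- L | z \notin Y])%N by rewrite size_filter_notin //; lia.
  rewrite lt0n size_eq0; apply/eqP => e.
  by have := mem_filter (fun z => z \notin Y) w L; rewrite e wY wL.
Qed.

Lemma Phi_linked t1 t2 la : linked t1 t2 la (Phi t1 t2 la).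
Proof.
rewrite /Phi /depth; case: ex_minnP => d /and3P[Dd /eqP z1 /eqP z2] _.
have bs t p : beta_set t1 t2 t d p =
  beads t (absz (d%:Z + 1 + t - Num.max t1 t2)%R) p by [].
rewrite !{}bs.
set n1 := absz _; set n2 := absz (_ + t2 - _)%R.
(* The lengths of the two lists are chosen so that both stop at this same level. *)
set base := Num.max t1 t2 - d%:Z - 1.
have en1 : t1 - n1%:Z = base by rewrite /base /n1; lia.
have en2 : t2 - n2%:Z = base by rewrite /base /n2; lia.
have dn1 : (d - absz (t1 - t2)%R <= n1)%N by lia.
have dn2 : (d - absz (t1 - t2)%R <= n2)%N by lia.
have := intpart_anti la.1 dn1; have := intpart_anti la.2 dn2.
rewrite z1 z2 !leqn0 => /eqP l2n /eqP l1n.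
clear Dd z1 z2 dn1 dn2; clearbody n1 n2 base.
have b1 x := mem_beads t1 x l1n; have b2 x := mem_beads t2 x l2n.
have g1 x := @beads_gt t1 n1 la.1 x; have g2 x := @beads_gt t2 n2 la.2 x.
have u1 := beads_uniq t1 n1 la.1; have u2 := beads_uniq t2 n2 la.2.
have s1 : size (beads t1 n1 la.1) = n1 by rewrite size_map size_iota.
have s2 : size (beads t2 n2 la.2) = n2 by rewrite size_map size_iota.
move: (beads t1 n1 la.1) (beads t2 n2 la.2) b1 b2 g1 g2 u1 u2 s1 s2.
move=> L1 L2 b1 b2 g1 g2 u1 u2 s1 s2.
rewrite en1 in b1 g1; rewrite en2 in b2 g2; rewrite -s1 in en1; rewrite -s2 in en2.
case: ifP => [t12|/negbT]; last rewrite -ltNge => t21.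
- have := picked_walk_bead nearest_below u1 u2 t12 en1 en2 g1 g2 b1 b2.
  cbv zeta; move: (intpart_of_beta t1 _) (intpart_of_beta t2 _) => m1 m2.
  move=> [E [EK E0 dE sums exc]]; exists E; split=> //; split=> //= x.
  + by rewrite {1}dE mul1r addrA.
  + by move=> /exc[-> ? ?]; split=> //; left.
(* The greedy list now belongs to component 2, whose change is opposite to that of component 1;
   hence the sign -1. *)
- have := picked_walk_bead nearest_above u2 u1 (ltW t21) en2 en1 g2 g1 b2 b1.
  cbv zeta; move: (intpart_of_beta t1 _) (intpart_of_beta t2 _) => m1 m2.
  move=> [E [EK E0 dE sums exc]]; exists E; split=> //; split=> //= x.
  + by rewrite {1}dE mulN1r opprB -addrA; congr (_ + _); have := sums x; lia.
  + by have := sums x; lia.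
  + move=> nx; have [|-> ? ?] := exc x; last by split=> //; right.
    by move: nx (sums x); do 4!case: (bead _ _ _).
Qed.

(** The inverse is [Phi] for the exchanged charges, applied to the exchanged components: flipping
    its link gives a link to [la], and the image under a link is unique. *)
Lemma PhiK t1 t2 la :
  Phi t1 t2 ((Phi t2 t1 (la.2, la.1)).2, (Phi t2 t1 (la.2, la.1)).1) = la.
Proof.
have := Phi_linked t2 t1 (la.2, la.1).
case: (Phi t2 t1 _) => nu2 nu1 /linked_flip /=; rewrite -surjective_pairing.
exact/linked_uniq/Phi_linked.
Qed.

Lemma Phi_bij t1 t2 : bijective (Phi t1 t2).
Proof.
exists (fun la => ((Phi t2 t1 (la.2, la.1)).2, (Phi t2 t1 (la.2, la.1)).1)) => la.
  by case: la => la1 la2; have /= -> := PhiK t2 t1 (la2, la1).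
exact: PhiK.
Qed.

Lemma Phi_invK t1 t2 : cancel (Phi_inv t1 t2) (Phi t1 t2).
Proof.
move=> la; have [g gK Kg] := Phi_bij t1 t2.
by apply: pinvK; rewrite inE /=; exists (g la).
Qed.

Lemma PhiKV t1 t2 : cancel (Phi t1 t2) (Phi_inv t1 t2).
Proof. by move=> la; apply: (bij_inj (Phi_bij t1 t2)); rewrite Phi_invK. Qed.

Lemma beads_sum t n (p : seq nat) : (size p <= n)%N ->
  (\sum_(x <- beads t n p) x) = (\sum_(q <- iota 0 n) (t - q%:Z)) + (sumn p)%:Z.
Proof.
move=> pn; rewrite big_map big_split /=; congr (_ + _).
have -> : sumn p = (\sum_(q <- iota 0 n) nth 0%N p q)%N.
  elim: p n pn => [|a p IH] [|n] //= pn; rewrite ?big_nil // big_cons /=.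
    by rewrite big1 // => q _; rewrite nth_nil.
  by rewrite (IH n) // -[1%N]addn0 iotaDl big_map.
by rewrite (big_morph Posz PoszD (erefl _)).
Qed.

(** Up to a constant depending on charge and cutoff only, the size of a partition is the sum of its
    beads above the cutoff, and a link preserves the joint multiset of beads. *)
Lemma linked_sumn t1 t2 (l1 l2 m1 m2 : intpart) :
  linked t1 t2 (l1, l2) (m1, m2) ->
  (sumn l1 + sumn l2 = sumn m1 + sumn m2)%N.
Proof.
move=> [_ [_ [_ _ /= sums _]]].
(* Large enough for the common cutoff [- K] to lie below the beads of all nonzero parts. *)
pose K := (size l1 + size l2 + size m1 + size m2 + absz t1 + absz t2)%N.
pose n1 := absz (K%:Z + t1)%R; pose n2 := absz (K%:Z + t2)%R.
have pn (p : intpart) n : (size p <= n)%N -> nth 0%N p n = 0%N by exact: nth_default.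
have ms t n (p : intpart) x : (size p <= n)%N -> t - n%:Z = - K%:Z ->
    bead t p x = (x \in beads t n p) || (x <= - K%:Z).
  by move=> /pn h <-; exact: mem_beads.
have [e1 e2] : t1 - n1%:Z = - K%:Z /\ t2 - n2%:Z = - K%:Z by rewrite /n1 /n2 /K; lia.
have [sl1 sl2] : (size l1 <= n1)%N /\ (size l2 <= n2)%N by rewrite /n1 /n2 /K; lia.
have [sm1 sm2] : (size m1 <= n1)%N /\ (size m2 <= n2)%N by rewrite /n1 /n2 /K; lia.
have : perm_eq (beads t1 n1 l1 ++ beads t2 n2 l2) (beads t1 n1 m1 ++ beads t2 n2 m2).
  apply/allP => x _ /=; rewrite !count_cat !count_uniq_mem ?beads_uniq //.
  have := sums x; rewrite !(ms t1 n1) ?(ms t2 n2) //; have [xK|Kx] := leP x (- K%:Z).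
    have out t n (p : intpart) : t - n%:Z = - K%:Z -> x \in beads t n p = false.
      by move=> tn; apply/negP => /beads_gt; rewrite tn ltNge xK.
    by rewrite !out.
  by rewrite !orbF => ->.
move=> ps; have : \sum_(x <- beads t1 n1 l1 ++ beads t2 n2 l2) x =
               \sum_(x <- beads t1 n1 m1 ++ beads t2 n2 m2) x by exact: perm_big.
rewrite !big_cat /= !beads_sum //.
lia.
Qed.

(** * Signature words *)

Section Words.
Variable l : nat.
Implicit Types (w u v : word l) (x : bool * node l).

Definition letter_sign x : int := if x.1 then 1 else -1.
Definition height w : int := \sum_(x <- w) letter_sign x.

Lemma height_cat u v : height (u ++ v) = height u + height v.
Proof. exact: big_cat. Qed.

Lemma height_cons x w : height (x :: w) = letter_sign x + height w.
Proof. exact: big_cons. Qed.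

Lemma height_rcons w x : height (rcons w x) = height w + letter_sign x.
Proof. by rewrite -cats1 height_cat height_cons /height big_nil addr0. Qed.

Lemma height_nil : height [::] = 0.
Proof. exact: big_nil. Qed.

Lemma height_map_A (s : seq (node l)) :
  height (map (@letterA l) s) = (size s)%:Z.
Proof.
elim: s => [|g s IH] /=; first exact: height_nil.
by rewrite height_cons IH /letter_sign /=; lia.
Qed.

Lemma height_map_R (s : seq (node l)) :
  height (map (@letterR l) s) = - (size s)%:Z.
Proof.
elim: s => [|g s IH] /=; first exact: height_nil.
by rewrite height_cons IH /letter_sign /=; lia.
Qed.

(* [g] carries the last [A] of the reduced word of [w]. *)
Definition last_unmatched_A w (g : node l) : Prop :=
  exists u v, [/\ w = u ++ letterA g :: v,
    forall k, 0 <= height (drop k u) & forall k, height (take k v) <= 0].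

Lemma deletes_RA_ctx u v w w' :
  deletes_RA w w' -> deletes_RA (u ++ w ++ v) (u ++ w' ++ v).
Proof.
elim=> [w0|a g h b w0 _ IH]; first exact: deletes_refl.
by move: IH; rewrite -!catA /= !(catA u); exact: deletes_step.
Qed.

Lemma deletes_RA_trans w1 w2 w3 :
  deletes_RA w1 w2 -> deletes_RA w2 w3 -> deletes_RA w1 w3.
Proof.
by elim=> [//|u g h v w _ IH] /IH; exact: deletes_step.
Qed.

(** The deletions are undone one at a time. A factor [RA] has suffix heights 0, 1, 0 and prefix
    heights 0, -1, 0, so reinserting it on either side of [g] breaks neither inequality. *)
Lemma deletes_RA_last w w' As Rs g : deletes_RA w w' ->
  w' = map (@letterA l) (rcons As g) ++ map (@letterR l) Rs ->
  last_unmatched_A w g.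
Proof.
elim=> {w w'} [w|u x y v w' _ IH] e.
  exists (map (@letterA l) As), (map (@letterR l) Rs); split=> [|k|k].
  - by rewrite e map_rcons cat_rcons.
  - by rewrite -map_drop height_map_A.
  - by rewrite -map_take height_map_R; lia.
have [a [b [uv ha hb]]] := IH e.
have [ua|au] := leqP (size u) (size a).
  have [a' ea] : exists a', a = u ++ a'.
    exists (drop (size u) a); rewrite -[LHS](cat_take_drop (size u)); congr (_ ++ _).
    by have := congr1 (take (size u)) uv; rewrite take_size_cat // takel_cat // => <-.
  have ev : v = a' ++ letterA g :: b.
    by have := congr1 (drop (size u)) uv; rewrite ea -catA !drop_size_cat.
  exists (u ++ [:: letterR x, letterA y & a']), b; split=> // [|k].
    by rewrite ev -catA.
  have h0 := ha 0%N; rewrite drop0 ea height_cat in h0.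
  rewrite drop_cat; case: ifP => ku.
    have := ha k; rewrite ea drop_cat ku !height_cat !height_cons /letter_sign /=; lia.
  have h1 : 0 <= height a' by have := ha (size u); rewrite ea drop_size_cat.
  case: (k - size u)%N => [|[|n]] /=; rewrite ?height_cons ?drop0 /letter_sign /=; try lia.
  by have := ha (size u + n)%N; rewrite ea drop_cat ltnNge leq_addr /= addKn.
have [b' eu] : exists b', u = a ++ letterA g :: b'.
  have := congr1 (take (size u)) uv; rewrite take_size_cat // take_cat ltnNge (ltnW au) /=.
  by rewrite -[(size u - size a)%N]prednK ?subn_gt0 //= => ->; eexists.
have eb : b = b' ++ v.
  have := congr1 (drop (size u)) uv; rewrite drop_size_cat // eu.
  rewrite size_cat /= drop_cat ltnNge leq_addr /= addKn => ->; move: uv.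
  rewrite eu -catA /= => /(congr1 (drop (size a).+1)).
  by rewrite -!cat_rcons !drop_size_cat ?size_rcons // => <-; rewrite drop_size_cat.
exists a, (b' ++ [:: letterR x, letterA y & v]); split=> // [|k].
  by rewrite eu -catA.
rewrite take_cat; case: ifP => kb.
  by have := hb k; rewrite eb take_cat kb.
have h1 : height b' <= 0 by have := hb (size b'); rewrite eb take_size_cat.
have hn n : height b' + height (take n v) <= 0.
  by have := hb (size b' + n)%N; rewrite eb take_cat ltnNge leq_addr /= addKn height_cat.
rewrite height_cat; case: (k - size b')%N => [|[|n]] /=;
  rewrite ?height_cons ?height_nil ?take0 ?height_nil /letter_sign /=; try lia.
have := hn n; lia.
Qed.

Lemma deletes_RA_allA u : (forall k, 0 <= height (drop k u)) ->
  exists2 As, height u = (size As)%:Z & deletes_RA u (map (@letterA l) As).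
Proof.
elim: u => [|[b g] u IH] hu; first by exists [::]; [exact: height_nil | exact: deletes_refl].
have [|As hA dA] := IH; first by move=> k; exact: (hu k.+1).
have := hu 0%N; rewrite drop0 height_cons /letter_sign /=; case: b {hu} => /= hu.
  exists (g :: As) => /=; first by rewrite hA; lia.
  by have := deletes_RA_ctx [:: letterA g] [::] dA; rewrite !cats0.
(* The new leading [R] cancels the first surviving [A], which exists because the whole word has
   nonnegative height. *)
case: As hA dA => [|a As] hA dA; first by move: hu; rewrite hA.
exists As; first by rewrite hA /=; lia.
have := deletes_RA_ctx [:: letterR g] [::] dA; rewrite !cats0 /= => d1.
by apply: deletes_RA_trans d1 _; apply: (@deletes_step _ [::]); exact: deletes_refl.
Qed.

Lemma deletes_RA_allR v : (forall k, height (take k v) <= 0) ->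
  exists2 Rs, height v = - (size Rs)%:Z & deletes_RA v (map (@letterR l) Rs).
Proof.
elim/last_ind: v => [|v [b g] IH] hv.
  by exists [::]; [exact: height_nil | exact: deletes_refl].
have [|Rs hR dR] := IH.
  move=> k; have [kv|vk] := leqP k (size v).
    by have := hv k; rewrite -cats1 takel_cat.
  have := hv (size v); rewrite -cats1 take_size_cat //.
  by rewrite take_oversize // ltnW.
have := hv (size v).+1; rewrite take_oversize ?size_rcons //.
rewrite height_rcons /letter_sign; case: b {hv} => /= hv.
  case/lastP: Rs hR dR => [|Rs r] hR dR; first by move: hv; rewrite hR.
  exists Rs; first by rewrite hR size_rcons; lia.
  have := deletes_RA_ctx [::] [:: letterA g] dR; rewrite /= cats1 => d1.
  apply: deletes_RA_trans d1 _; rewrite map_rcons cat_rcons.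
  by apply: deletes_step; rewrite cats0; exact: deletes_refl.
exists (rcons Rs g); first by rewrite hR size_rcons; lia.
by have := deletes_RA_ctx [::] [:: letterR g] dR; rewrite /= !cats1 map_rcons.
Qed.

Lemma last_unmatched_A_deletes w g : last_unmatched_A w g ->
  exists As Rs, deletes_RA w
    (map (@letterA l) (rcons As g) ++ map (@letterR l) Rs).
Proof.
move=> [u [v [-> /deletes_RA_allA[As _ dA] /deletes_RA_allR[Rs _ dR]]]].
exists As, Rs; rewrite map_rcons cat_rcons.
have := deletes_RA_ctx [::] (letterA g :: v) dA => /= d1.
apply: deletes_RA_trans d1 _.
have := deletes_RA_ctx (rcons (map (@letterA l) As) (letterA g)) [::] dR.
by rewrite !cats0 !cat_rcons.
Qed.

End Words.

(** * Addable and removable nodes as sites *)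

Section Sites.
Variables (l e : nat) (s t : {ffun 'I_l -> int}).
Hypothesis ts : forall c, (t c)%:~R = (s c)%:~R :> 'Z_e.
Implicit Types (la mu : multipartition l) (m : {ffun 'I_l -> rat})
  (g : node l) (w : word l) (z : 'Z_e).

(* A component together with a charged content: it locates at most one addable
   or removable node of a given multipartition. *)
Definition site : Type := 'I_l * int.

(** Contents are charged by [t], not by [s]: residues only need [t] congruent to [s] modulo [e], and
    the order on nodes is independent of [t]. This freedom lets exchanged nodes have equal charged
    content. *)
Definition site_of g : site :=
  (node_comp g, (node_col g)%:Z - (node_row g)%:Z + t (node_comp g)).

Definition site_val m (h : site) : rat := (h.2 - t h.1)%:~R + m h.1.

Definition site_sgn la (h : site) : int := sgn (t h.1) (la h.1) h.2.

Definition site_moves la (h : site) mu : Prop :=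
  (forall c, c != h.1 -> mu c = la c) /\
  moves_bead (t h.1) (la h.1) h.2 (mu h.1).

Lemma residue_site g : residue e s g = (site_of g).2%:~R.
Proof. by rewrite /residue /= !rmorphD /= ts. Qed.

Lemma node_lt_site m g g' :
  node_lt m g g' = (site_val m (site_of g) < site_val m (site_of g')).
Proof. by rewrite /node_lt /site_val /= !addrK. Qed.

Lemma adds_nodeP la g mu : adds_node la g mu <->
  [/\ node_col g = nth 0%N (la (node_comp g)) (node_row g),
    incr_row (la (node_comp g)) (node_row g) (mu (node_comp g)) &
    forall c, c != node_comp g -> mu c = la c].
Proof.
case: g => [[a b] c]; rewrite /adds_node /in_diagram /=; split.
  case=> nin h; have off a' c' : (a', c') != (a, c) ->
      nth 0%N (mu c') a' = nth 0%N (la c') a'.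
    move=> ne; have h' b' := h (a', b', c'); move: h'; rewrite /node_comp /node_row /node_col /=.
    have nb b' : ((a', b', c') == (a, b, c)) = false.
      by apply/eqP => -[ea _ ec]; rewrite ea ec eqxx in ne.
    move=> h'; have := h' (nth 0 (mu c') a')%N; have := h' (nth 0 (la c') a')%N.
    by rewrite !nb !ltnn /= => /negbT; rewrite -leqNgt => h1 /esym/negbT; rewrite -leqNgt; lia.
  have on b' : (b' < nth 0 (mu c) a)%N = (b' == b) || (b' < nth 0 (la c) a)%N.
    by have := h (a, b', c); rewrite /node_comp /node_row /node_col /= !xpair_eqE !eqxx andbT.
  move: nin; rewrite /node_comp /node_row /node_col /= -leqNgt => nin.
  have eb : b = nth 0%N (la c) a.
    have := on b; rewrite eqxx /= => bm; have := on (nth 0 (la c) a)%N.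
    rewrite ltnn orbF; case: eqP => // _; lia.
  split=> // [a'|c' cc].
    case: eqP => [->|/eqP aa]; last by rewrite addn0 off // xpair_eqE negb_and aa.
    have := on b; have := on b.+1; rewrite -eb eqxx; lia.
  by apply: intpart_ext => a'; rewrite off // xpair_eqE negb_and cc orbT.
rewrite /node_comp /node_row /node_col /= => -[eb hi off].
split; first by rewrite eb ltnn.
case=> [[a' b'] c'] /=; rewrite !xpair_eqE.
case: (c' =P c) => [->|/eqP cc]; last by rewrite off // andbF.
rewrite andbT hi; case: (a' =P a) => [->|_] /=; last by rewrite addn0.
by rewrite -eb addn1 ltnS leq_eqVlt.
Qed.

Lemma adds_node_site_moves la g mu :
  adds_node la g mu -> site_moves la (site_of g) mu.
Proof.
move=> /adds_nodeP[eb hi off]; split=> //=.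
have -> : (node_col g)%:Z - (node_row g)%:Z + t (node_comp g) =
  t (node_comp g) - (node_row g)%:Z + (nth 0%N (la (node_comp g)) (node_row g))%:Z.
  by rewrite -eb; lia.
split; first exact: bead_row.
- exact: incr_row_above hi.
- by move=> x; exact: incr_row_bead.
Qed.

Lemma site_moves_uniq la h mu mu' :
  site_moves la h mu -> site_moves la h mu' -> mu = mu'.
Proof.
move=> [off [_ _ mv]] [off' [_ _ mv']]; apply/ffunP => c.
have [->|ch] := eqVneq c h.1; last by rewrite off ?off'.
by apply: (@bead_ext (t h.1)) => x; rewrite mv mv'.
Qed.

Lemma site_moves_sgn la h mu : site_moves la h mu -> site_sgn la h = 1.
Proof. by case=> _ [b0 /negbTE b1 _]; rewrite /site_sgn /sgn b0 b1. Qed.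

Lemma addable_sgn la g : addable la g -> site_sgn la (site_of g) = 1.
Proof. by case=> mu /adds_node_site_moves/site_moves_sgn. Qed.

Lemma removable_sgn la g : removable la g -> site_sgn la (site_of g) = -1.
Proof.
case=> mu /adds_node_site_moves[_ [b0 b1 mv]]; rewrite /site_sgn /sgn !mv !eqxx /=.
rewrite andbF orbF; case: eqP => //; lia.
Qed.

Lemma addable_site_inj la g g' :
  addable la g -> addable la g' -> site_of g = site_of g' -> g = g'.
Proof.
move=> [mu /adds_nodeP[eb _ _]] [mu' /adds_nodeP[eb' _ _]].
case: g g' eb eb' => [[a b] c] [[a' b'] c'].
rewrite /site_of /node_comp /node_row /node_col /= => -> -> [cc ea]; subst c'.
suff -> : a = a' by [].
apply: (@bead_row_inj (t c) (la c)); lia.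
Qed.

Lemma removable_site_inj la g g' :
  removable la g -> removable la g' -> site_of g = site_of g' -> g = g'.
Proof.
move=> [mu /adds_nodeP[eb hi _]] [mu' /adds_nodeP[eb' hi' _]].
case: g g' eb eb' hi hi' => [[a b] c] [[a' b'] c'].
rewrite /site_of /node_comp /node_row /node_col /= => -> -> hi hi' [cc ea]; subst c'.
have := hi a; have := hi' a'; rewrite !eqxx => h' h.
suff aa : a = a'.
  by subst a'; congr (_, _, _); lia.
apply: (@bead_row_inj (t c) (la c)); lia.
Qed.

(** The premise stands inside the existential so that [choice] yields a function on all sites; where
    the sign is 0 the value is a dummy. *)
Lemma sgn_node la h : exists x : bool * node l, site_sgn la h != 0 ->
  [/\ site_of x.2 = h, letter_sign x = site_sgn la h,
      x.1 -> addable la x.2 & ~~ x.1 -> removable la x.2].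
Proof.
case: h => c y; rewrite /site_sgn /sgn /=.
case b0: (bead (t c) (la c) y); case b1: (bead (t c) (la c) (y + 1)) => /=;
  try by exists (true, (0%N, 0%N, c)).
- case/beadP: b0 b1 => a -> b1; exists (true, (a, nth 0%N (la c) a, c)) => _.
  split=> //; first by rewrite /site_of /node_comp /node_row /node_col /=; congr (_, _); lia.
  move=> _; have [|p' hp] := @incr_row_ex (t c) (la c) a; first by rewrite b1.
  exists [ffun c' => if c' == c then p' else la c']; apply/adds_nodeP.
  split=> //= [|c' cc]; first by rewrite ffunE eqxx.
  by rewrite ffunE (negbTE cc).
- have /beadP[a ea] := b1.
  have [|p' hp] := @decr_row_ex (t c) (la c) a.
    by rewrite -ea addrK b0.
  have pa := hp a; rewrite eqxx in pa.
  exists (false, (a, nth 0%N p' a, c)) => _.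
  split=> //; first by rewrite /site_of /node_comp /node_row /node_col /=; congr (_, _); lia.
  move=> _; exists [ffun c' => if c' == c then p' else la c']; apply/adds_nodeP.
  rewrite /= ffunE eqxx; split=> // c' cc.
  by rewrite ffunE (negbTE cc).
Qed.

End Sites.

(** * The signature rule as a first maximum of partial sums *)

Section SortedWords.
Variables (T : eqType) (f : T -> rat).
Implicit Types (w u v : seq T) (P : pred rat).

Let ltf x y := f x < f y.

Lemma ltf_trans : transitive ltf.
Proof. by move=> x y z; exact: lt_trans. Qed.

Lemma sorted_split u x v : sorted ltf (u ++ x :: v) ->
  (forall y, y \in u -> f y < f x) /\ (forall y, y \in v -> f x < f y).
Proof.
rewrite (sorted_pairwise ltf_trans) pairwise_cat /= => /and3P[/allrelP h _ /andP[/allP k _]].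
split=> y yu; last exact: k.
by apply: h; rewrite ?mem_head.
Qed.

Lemma filter_down P w : {homo P : a b / b <= a >-> a ==> b} ->
  sorted ltf w -> exists k, [seq x <- w | P (f x)] = take k w.
Proof.
move=> down; elim: w => [|x w IH] sw; first by exists 0%N.
have [k e] := IH (path_sorted sw); rewrite /= e.
case: ifP => Px; first by exists k.+1.
exists 0%N; rewrite take0 -e; apply/eqP; rewrite -[_ == _]negbK -has_filter.
have /allP lx := order_path_min ltf_trans sw.
apply/hasPn => y /lx /ltW xy; apply/negP => Py.
by have := down _ _ xy; rewrite Py Px.
Qed.

End SortedWords.

Section FirstMax.
Variables (l e : nat) (s t : {ffun 'I_l -> int}) (m : {ffun 'I_l -> rat}).
Hypothesis ts : forall c, (t c)%:~R = (s c)%:~R :> 'Z_e.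
Implicit Types (la mu : multipartition l) (g h : site l) (P : pred rat).

Definition sites (Y : seq int) : seq (site l) :=
  [seq (c, y) | c <- enum 'I_l, y <- Y].

Lemma mem_sites Y h : (h \in sites Y) = (h.2 \in Y).
Proof.
apply/allpairsP/idP => [[[c y] [_ /= yY ->]] //|hY].
by exists h; rewrite mem_enum; case: h hY.
Qed.

Lemma sites_uniq Y : uniq Y -> uniq (sites Y).
Proof.
move=> uY; apply: allpairs_uniq => //; first exact: enum_uniq.
by move=> [c y] [c' y'] _ _ [-> ->].
Qed.

Definition site_sum Y la P : int :=
  \sum_(h <- sites Y | P (site_val t m h)) site_sgn t la h.

Definition sum_lt Y la h := site_sum Y la (fun r => r < site_val t m h).
Definition sum_le Y la h := site_sum Y la (fun r => r <= site_val t m h).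

(** The sums play the role of heights of prefixes of the signature word: strictly lower before [g],
    at most as high after it. All sites over [Y] are tested, also those of sign 0, so that different
    multipartitions are compared at the same sites. *)
Definition first_max Y la g : Prop :=
  [/\ g.2 \in Y, site_sgn t la g = 1, sum_lt Y la g < sum_le Y la g,
    forall h, h.2 \in Y -> site_val t m h < site_val t m g ->
      sum_lt Y la h < sum_le Y la g /\ sum_le Y la h < sum_le Y la g &
    forall h, h.2 \in Y -> site_val t m g < site_val t m h ->
      sum_lt Y la h <= sum_le Y la g /\ sum_le Y la h <= sum_le Y la g].

Definition covers Y (z : 'Z_e) la : Prop :=
  [/\ uniq Y, forall y, y \in Y -> y%:~R = z &
      forall h : site l, site_sgn t la h != 0 -> h.2%:~R = z -> h.2 \in Y].

Section Signature.
Variables (Y : seq int) (z : 'Z_e) (la : multipartition l) (w : word l).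
Hypotheses (Yla : covers Y z la) (sw : signature m s z la w).

Let f (x : bool * node l) := site_val t m (site_of t x.2).

Let sorted_w : sorted (fun x y => f x < f y) w.
Proof.
case: sw => so _ _; apply: sub_sorted so => x y.
by rewrite (node_lt_site t).
Qed.

Lemma signature_letter x : x \in w ->
  site_sgn t la (site_of t x.2) = letter_sign x /\ (site_of t x.2).2 \in Y.
Proof.
case: Yla => _ _ cov; case: sw => _ hA hR; case: x => [[] g] xw.
  have [ag rg] := (hA g).1 xw; have sg := addable_sgn t ag.
  by rewrite sg; split=> //; apply: cov; rewrite ?sg // -rg (residue_site ts).
have [ag rg] := (hR g).1 xw; have sg := removable_sgn t ag.
by rewrite sg; split=> //; apply: cov; rewrite ?sg // -rg (residue_site ts).
Qed.

Lemma signature_site h : h.2 \in Y -> site_sgn t la h != 0 ->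
  exists2 x, x \in w & site_of t x.2 = h.
Proof.
case: Yla => _ Yz _ /Yz hz nz; have [x /(_ nz) [hx _ ax rx]] := sgn_node t la h.
exists x => //; case: sw => _ hA hR; move: ax rx hx; case: x => [[] g] /= ax rx hx.
  by apply/hA; split; [exact: ax | rewrite (residue_site ts) hx].
by apply/hR; split; [exact: rx | rewrite (residue_site ts) hx].
Qed.

(** Sites of sign 0 contribute nothing, and the others correspond bijectively to the letters of
    [w]. *)
Lemma site_sum_word P :
  site_sum Y la P = height [seq x <- w | P (f x)].
Proof.
have [uY _ _] := Yla.
rewrite /site_sum (bigID (fun h => site_sgn t la h == 0)) /= [X in X + _]big1 ?add0r; last first.
  by move=> h /andP[_ /eqP].
have pe : perm_eq [seq h <- sites Y | site_sgn t la h != 0] [seq site_of t x.2 | x <- w].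
  apply: uniq_perm.
  - by rewrite filter_uniq // sites_uniq.
  - have ltt : transitive (fun h h' : site l => site_val t m h < site_val t m h').
      by move=> x y ? /=; exact: lt_trans.
    apply: (sorted_uniq ltt); first by move=> h; rewrite /= ltxx.
    by rewrite sorted_map.
  move=> h; rewrite mem_filter mem_sites; apply/andP/mapP => [[nz hY]|[x xw ->]].
    by have [x xw <-] := signature_site hY nz; exists x.
  by have [-> hY] := signature_letter xw; split=> //; rewrite /letter_sign; case: x.1.
under eq_bigl do rewrite andbC.
rewrite -big_filter_cond (perm_big _ pe) big_map /height big_filter.
rewrite big_seq_cond [RHS]big_seq_cond; apply: eq_bigr => x /andP[xw _].
by have [-> _] := signature_letter xw.
Qed.

Lemma sums_at u x v : w = u ++ x :: v ->
  sum_lt Y la (site_of t x.2) = height u /\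
  sum_le Y la (site_of t x.2) = height (rcons u x).
Proof.
move=> ew; have [hu hv] := sorted_split (f := f) (eq_ind w (sorted _) sorted_w _ ew).
rewrite /sum_lt /sum_le !site_sum_word ew !filter_cat /= ltxx lexx -/(f x).
have -> : [seq y <- u | f y < f x] = u by apply/all_filterP/allP.
have -> : [seq y <- u | f y <= f x] = u by apply/all_filterP/allP => y /hu /ltW.
have -> : [seq y <- v | f y < f x] = [::].
  apply/eqP; rewrite -[_ == _]negbK -has_filter; apply/hasPn => y /hv.
  by rewrite -leNgt => /ltW.
have -> : [seq y <- v | f y <= f x] = [::].
  by apply/eqP; rewrite -[_ == _]negbK -has_filter; apply/hasPn => y /hv; rewrite -ltNge.
by rewrite cats0 cats1.
Qed.

Lemma last_unmatched_first_max (g : node l) :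
  last_unmatched_A w g -> first_max Y la (site_of t g).
Proof.
move=> [u [v [ew hu hv]]].
have xw : letterA g \in w by rewrite ew mem_cat mem_head orbT.
have [sg gY] := signature_letter xw; have [slt sle] := sums_at ew.
have [lu lv] := sorted_split (f := f) (eq_ind w (sorted _) sorted_w _ ew).
have [su sv] : sorted (fun x y => f x < f y) u /\ sorted (fun x y => f x < f y) v.
  move: sorted_w; rewrite ew (sorted_pairwise (@ltf_trans _ f)) pairwise_cat /=.
  by rewrite -!(sorted_pairwise (@ltf_trans _ f)) => /and3P[_ -> /andP[_ ->]].
(* A downward closed [P] cuts out a prefix of the sorted word; this covers [sum_lt] and [sum_le]
   together. *)
have below P : {homo P : a b / b <= a >-> a ==> b} -> ~~ P (f (letterA g)) ->
    site_sum Y la P < sum_le Y la (site_of t g).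
  move=> down nP; rewrite sle site_sum_word ew filter_cat /= (negbTE nP).
  have -> : [seq x <- v | P (f x)] = [::].
    apply/eqP; rewrite -[_ == _]negbK -has_filter; apply/hasPn => y /lv /ltW gy.
    by apply: contra nP => Py; have := down _ _ gy; rewrite Py.
  have [k ->] := filter_down down su; have := hu k.
  have := congr1 (@height l) (cat_take_drop k u).
  by rewrite cats0 height_rcons height_cat ltzD1 => <-; rewrite lerDl.
have above P : {homo P : a b / b <= a >-> a ==> b} -> P (f (letterA g)) ->
    site_sum Y la P <= sum_le Y la (site_of t g).
  move=> down Pg; rewrite sle site_sum_word ew filter_cat /= Pg.
  have -> : [seq x <- u | P (f x)] = u.
    apply/all_filterP/allP => y /lu /ltW gy.
    by have := down _ _ gy; rewrite Pg.
  have [k ->] := filter_down down sv; have := hv k.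
  by rewrite height_rcons height_cat height_cons => tk; rewrite lerD2l gerDl.
have dlt r : {homo (fun a => a < r) : a b / b <= a >-> a ==> b}.
  by move=> a b ba; apply/implyP; exact: le_lt_trans.
have dle r : {homo (fun a => a <= r) : a b / b <= a >-> a ==> b}.
  by move=> a b ba; apply/implyP; exact: le_trans.
split=> //.
- by rewrite slt sle height_rcons /letter_sign /=; lia.
- by move=> h hY hg; split; apply: below => //; rewrite -?leNgt -?ltNge // ltW.
- by move=> h hY hg; split; apply: above => //; exact: ltW.
Qed.

Lemma first_max_last_unmatched g : first_max Y la g ->
  exists2 n, site_of t n = g & letterA n \in w /\ last_unmatched_A w n.
Proof.
move=> [gY sg lt_le below above].
have [|[b n] xw /= en] := signature_site gY; first by rewrite sg.
have [] := signature_letter xw; rewrite /= en sg => eb _.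
case: b xw eb => // xw _; subst g; exists n => //; split=> //.
have [u [v ew]] : exists u v, w = u ++ letterA n :: v.
  by case/splitPr: xw => u v; exists u, v.
exists u, v; split=> // k.
  have [ku|uk] := ltnP k (size u); last by rewrite drop_oversize // height_nil.
  have eu := drop_nth (letterA n) ku; set y := nth _ u k in eu.
  have [lu _] := sorted_split (f := f) (eq_ind w (sorted _) sorted_w _ ew).
  have yu : y \in u by apply: mem_nth.
  have yw : y \in w by rewrite ew mem_cat yu.
  have [_ hY] := signature_letter yw.
  have [sn_lt sn_le] := sums_at ew.
  have [h1 _] := below _ hY (lu y yu).
  have [sy _] : sum_lt Y la (site_of t y.2) = height (take k u) /\
     sum_le Y la (site_of t y.2) = height (rcons (take k u) y).
    apply: (sums_at (v := drop k.+1 u ++ letterA n :: v)).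
    by rewrite -cat_cons -eu catA cat_take_drop.
  have := congr1 (@height l) (cat_take_drop k u).
  by move: h1; rewrite sy sn_le height_rcons height_cat ltzD1 => + e1; rewrite -e1 lerDl.
have [k' ek kv] : exists2 k', take k v = take k' v & (k' <= size v)%N.
  exists (minn k (size v)); last exact: geq_minr.
  by case: (leqP k (size v)) => // vk; rewrite !take_oversize // ltnW.
rewrite {}ek; case: k' kv => [|{}k] kv; first by rewrite take0 height_nil.
have ev := drop_nth (letterA n) kv; set y := nth _ v k in ev.
have [_ lv] := sorted_split (f := f) (eq_ind w (sorted _) sorted_w _ ew).
have yv : y \in v by apply: mem_nth.
have yw : y \in w by rewrite ew mem_cat inE yv !orbT.
have [_ hY] := signature_letter yw.
have [sn_lt sn_le] := sums_at ew.
have [_ h1] := above _ hY (lv y yv).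
have [_ sy] : sum_lt Y la (site_of t y.2) = height (u ++ letterA n :: take k v) /\
     sum_le Y la (site_of t y.2) = height (rcons (u ++ letterA n :: take k v) y).
  by apply: (sums_at (v := drop k.+1 v)); rewrite -catA /= -ev cat_take_drop.
move: h1; rewrite sy sn_le (take_nth (letterA n)) // -/y.
by rewrite !height_rcons height_cat height_cons -!addrA lerD2l gerDl.
Qed.

End Signature.
End FirstMax.

Section CrystalFirstMax.
Variables (l e : nat) (s t : {ffun 'I_l -> int}) (m : {ffun 'I_l -> rat}).
Hypothesis ts : forall c, (t c)%:~R = (s c)%:~R :> 'Z_e.
Implicit Types (la mu : multipartition l) (Y : seq int) (z : 'Z_e).

Lemma signature_exists Y z la : covers t Y z la ->
  {in sites l Y &, injective (site_val t m)} -> exists w, signature m s z la w.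
Proof.
move=> [uY Yz cov] inj; have [nd ndP] := choice (sgn_node t la).
pose S := [seq h <- sites l Y | site_sgn t la h != 0].
pose S' := sort (relpre (site_val t m) <=%R) S.
have mS h : (h \in S') = (site_sgn t la h != 0) && (h.2 \in Y).
  by rewrite mem_sort mem_filter mem_sites.
exists (map nd S'); split.
- have : sorted <%R (map (site_val t m) S').
    rewrite lt_sorted_uniq_le -sort_map sort_uniq sort_sorted ?andbT; last exact: le_total.
    rewrite map_inj_in_uniq ?filter_uniq ?sites_uniq // => h h'.
    by rewrite !mem_filter => /andP[_ hY] /andP[_ hY']; exact: inj.
  rewrite !sorted_map; apply: (@sub_in_sorted _ (mem S')); last exact/allP.
  move=> h h' hS hS'; have {hS} : h \in S' := hS; have {hS'} : h' \in S' := hS'.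
  rewrite !mS => /andP[nz' _] /andP[nz _] /=.
  by rewrite (node_lt_site t); case: (ndP h nz) => -> _ _ _; case: (ndP h' nz') => -> _ _ _.
- move=> g; split=> [/mapP[h]|[ag rg]].
    rewrite mS => /andP[nz hY] e1; have [hs _ ah _] := ndP h nz.
    rewrite -e1 /= in hs ah; split; first exact: ah.
    by rewrite (residue_site ts) hs Yz.
  have sg := addable_sgn t ag; have nz : site_sgn t la (site_of t g) != 0 by rewrite sg.
  apply/mapP; exists (site_of t g).
    by rewrite mS nz cov // -(residue_site ts).
  have [] := ndP _ nz; rewrite sg; case: (nd _) => [[] g'] // hs _ /(_ isT) ag' _.
  by congr (_, _); apply: (addable_site_inj ag ag' (esym hs)).
- move=> g; split=> [/mapP[h]|[ag rg]].
    rewrite mS => /andP[nz hY] e1; have [hs _ _ ah] := ndP h nz.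
    rewrite -e1 /= in hs ah; split; first exact: ah.
    by rewrite (residue_site ts) hs Yz.
  have sg := removable_sgn t ag; have nz : site_sgn t la (site_of t g) != 0 by rewrite sg.
  apply/mapP; exists (site_of t g).
    by rewrite mS nz cov // -(residue_site ts).
  have [] := ndP _ nz; rewrite sg; case: (nd _) => [[] g'] // hs _ _ /(_ isT) ag'.
  by congr (_, _); apply: (removable_site_inj ag ag' (esym hs)).
Qed.

Lemma crystal_first_max Y z la mu : covers t Y z la ->
  crystal m s la z mu -> exists2 g, first_max t m Y la g & site_moves t la g mu.
Proof.
move=> cov [w [As [Rs [g [sw dw ad]]]]]; exists (site_of t g).
  apply: (last_unmatched_first_max ts cov sw).
  exact: deletes_RA_last dw (erefl _).
exact: adds_node_site_moves.
Qed.

Lemma first_max_crystal Y z la mu g : covers t Y z la ->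
  {in sites l Y &, injective (site_val t m)} ->
  first_max t m Y la g -> site_moves t la g mu -> crystal m s la z mu.
Proof.
move=> cov inj fm mv; have [w sw] := signature_exists cov inj.
have [n en [nw /last_unmatched_A_deletes[As [Rs dw]]]] :=
  first_max_last_unmatched ts cov sw fm.
exists w, As, Rs, n; split=> //.
have [_ hA _] := sw; have [[mu' ad] _] := (hA n).1 nw.
have mv' := adds_node_site_moves t ad; rewrite en in mv'.
by rewrite (site_moves_uniq mv mv').
Qed.

Lemma site_moves_exists la h : site_sgn t la h = 1 -> exists mu, site_moves t la h mu.
Proof.
move=> sh; have [[b n]] := sgn_node t la h.
rewrite sh => /(_ isT)[/= <-]; case: b => // _ /(_ isT)[mu ad] _.
by exists mu; exact: adds_node_site_moves.
Qed.

Lemma covers_exists z la la' : exists Y, covers t Y z la /\ covers t Y z la'.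
Proof.
(* For contents outside [[- K - 1, K]] the positions [y] and [y + 1] are both full or both empty in
   every component, so the sign is 0. *)
pose bound (nu : multipartition l) c := (absz (t c) + size (nu c) + nth 0 (nu c) 0)%N.
pose K := (\sum_c (bound la c + bound la' c))%N.
have leK c : (bound la c + bound la' c <= K)%N.
  by rewrite /K (bigD1 c) //= leq_addr.
exists [seq y <- [seq n%:Z - K%:Z - 1 | n <- iota 0 (2 * K + 2)] | y%:~R == z].
have cv nu : (forall c, bound nu c <= K)%N ->
    covers t [seq y <- [seq n%:Z - K%:Z - 1 | n <- iota 0 (2 * K + 2)] | y%:~R == z] z nu.
  move=> bK; split.
  - rewrite filter_uniq // map_inj_uniq ?iota_uniq // => a b; lia.
  - by move=> y; rewrite mem_filter => /andP[/eqP].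
  move=> [c y] nz yz; rewrite mem_filter yz eqxx /=; move: nz.
  apply: contraR => ny; have {}ny : y < - K%:Z - 1 \/ K%:Z < y.
    have [lo|hi] := ltP y (- K%:Z - 1); first by left.
    have [hi'|lo'] := ltP K%:Z y; first by right.
    case/mapP: ny; exists (absz (y + K%:Z + 1)%R); [rewrite mem_iota|]; lia.
  rewrite /site_sgn /sgn /=; have := bK c; rewrite /bound => bc.
  case: ny => hy.
    by rewrite !bead_low //; lia.
  by rewrite !(negbTE (bead_high _)) //; lia.
by split; apply: cv => c; have := leK c; lia.
Qed.

End CrystalFirstMax.

(** * Exchanging adjacent nodes of two components *)

Section Crossing.
Variables (l e : nat) (t : {ffun 'I_l -> int}).
Implicit Types (la mu : multipartition l) (g h : site l)
  (m : {ffun 'I_l -> rat}).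

Definition linked_at (i j : 'I_l) la la' : Prop :=
  (forall c, c != i -> c != j -> la' c = la c) /\
  linked (t j) (t i) (la j, la i) (la' j, la' i).

Definition same_residue h h' : Prop := h.2%:~R = h'.2%:~R :> 'Z_e.

Definition in_pair (i j : 'I_l) (y : int) h : bool :=
  (h.2 == y) && ((h.1 == i) || (h.1 == j)).

(* [m] and [m'] order sites of equal residue in the same way, except that the
   sites of [i] and [j] of equal charged content are exchanged. *)
Definition crossing (i j : 'I_l) m m' : Prop :=
  [/\ i != j,
    forall h h', same_residue h h' ->
      ~~ (in_pair i j h'.2 h && in_pair i j h'.2 h' && (h.1 != h'.1)) ->
      (site_val t m h < site_val t m h') = (site_val t m' h < site_val t m' h'),
    forall y, site_val t m (i, y) < site_val t m (j, y),
    forall y, site_val t m' (j, y) < site_val t m' (i, y) &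
    forall h h', same_residue h h' ->
      site_val t m h = site_val t m h' \/ site_val t m' h = site_val t m' h' ->
      h = h'].

Lemma crossing_sym i j m m' : crossing i j m m' -> crossing j i m' m.
Proof.
move=> [ij ord lt lt' inj]; split=> // [|h h' hh' np|h h' hh' vv].
- by rewrite eq_sym.
- rewrite ord //; move: np; rewrite /in_pair; apply: contra.
  by rewrite !(orbC (_ == i)).
- by apply: inj => //; case: vv; [right|left].
Qed.

Section Order.
Variables (i j : 'I_l) (m m' : {ffun 'I_l -> rat}).
Hypothesis cr : crossing i j m m'.
Local Notation v := (site_val t m).
Local Notation v' := (site_val t m').

(** No site lies between [(i, y)] and [(j, y)]: its order with respect to both would be the same for
    [m'], contradicting that [m'] puts [(j, y)] first. *)
Lemma crossing_near y h : same_residue (i, y) h -> ~~ in_pair i j y h ->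
  (v h < v (i, y)) = (v h < v (j, y)) /\ (v (i, y) < v h) = (v (j, y) < v h).
Proof.
case: cr => ij ord lt lt' inj hy np.
have yh : same_residue (j, y) h by [].
have npi : ~~ (in_pair i j h.2 (i, y) && in_pair i j h.2 h && (i != h.1)).
  apply: contra np => /andP[/andP[]]; rewrite /in_pair /= => /andP[/eqP -> _].
  by [].
have npj : ~~ (in_pair i j h.2 (j, y) && in_pair i j h.2 h && (j != h.1)).
  apply: contra np => /andP[/andP[]]; rewrite /in_pair /= => /andP[/eqP -> _].
  by [].
have nbi : v (i, y) != v h.
  apply/eqP => vh; have eh := inj _ _ hy (or_introl vh).
  by move: np; rewrite -eh /in_pair !eqxx.
have nbj : v (j, y) != v h.
  apply/eqP => vh; have eh := inj _ _ yh (or_introl vh).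
  by move: np; rewrite -eh /in_pair !eqxx orbT.
have oi := ord _ _ hy npi; have oj := ord _ _ yh npj.
have ty := lt y; have ty' := lt' y.
have nb : v h < v (i, y) \/ v (j, y) < v h.
  case: (ltgtP (v h) (v (i, y))) nbi => // [|ih _]; first by left.
  case: (ltgtP (v h) (v (j, y))) nbj => // [hj _|]; last by right.
  exfalso; have := ih; rewrite oi => ih'.
  have : ~~ (v (j, y) < v h) by rewrite -leNgt ltW.
  by rewrite oj (lt_trans ty' ih').
case: nb => hv.
  by rewrite hv (lt_trans hv ty) (lt_gtF hv) (lt_gtF (lt_trans hv ty)).
by rewrite hv (lt_trans ty hv) (lt_gtF hv) (lt_gtF (lt_trans ty hv)).
Qed.

Lemma big_sites Y (F : site l -> int) P :
  \sum_(h <- sites l Y | P h) F h =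
  \sum_c \sum_(y <- Y) (if P (c, y) then F (c, y) else 0).
Proof. by rewrite big_mkcond /sites big_allpairs_dep /= big_enum. Qed.

(** The predicates never separate the two sites of a block, so only the block totals matter, and
    these agree. *)
Lemma site_sum_agree Y la la' (P P' : pred (site l)) :
  (forall h, h.2 \in Y -> h.1 != i -> h.1 != j -> P h = P' h) ->
  (forall y, y \in Y ->
     [/\ P (j, y) = P (i, y), P' (i, y) = P (i, y) & P' (j, y) = P (i, y)]) ->
  (forall c, c != i -> c != j -> la' c = la c) ->
  (forall y, site_sgn t la (j, y) + site_sgn t la (i, y) =
             site_sgn t la' (j, y) + site_sgn t la' (i, y)) ->
  \sum_(h <- sites l Y | P h) site_sgn t la h =
  \sum_(h <- sites l Y | P' h) site_sgn t la' h.
Proof.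
case: cr => ij _ _ _ _ PP' Pij off sums; rewrite !big_sites.
have ji : j != i by rewrite eq_sym.
rewrite (bigD1 i) //= (bigD1 j) //= [RHS](bigD1 i) //= [X in _ = _ + X](bigD1 j) //=.
rewrite !addrA -!big_split /=; congr (_ + _).
  rewrite !big_seq; apply: eq_bigr => y yY.
  have [-> -> ->] := Pij y yY; case: ifP => // _.
  by rewrite addrC sums addrC.
apply: eq_bigr => c /andP[ci cj]; rewrite !big_seq; apply: eq_bigr => y yY.
by rewrite PP' //= /site_sgn /= off.
Qed.

Section Sums.
Variables (Y : seq int) (z : 'Z_e) (la la' : multipartition l).
Hypotheses (cov : covers t Y z la) (lk : linked_at i j la la').

Let Yres h h' : h.2 \in Y -> h'.2 \in Y -> same_residue h h'.
Proof. by case: cov => _ Yz _ /Yz + /Yz; rewrite /same_residue => -> ->. Qed.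

Let sums y : site_sgn t la (j, y) + site_sgn t la (i, y) =
             site_sgn t la' (j, y) + site_sgn t la' (i, y).
Proof. by case: lk => _ /(linked_sgn y)[]. Qed.

Lemma sum_le_ltE nu h : h.2 \in Y ->
  sum_le t m Y nu h = sum_lt t m Y nu h + site_sgn t nu h.
Proof.
move=> hY; have [uY _ _] := cov; case: cr => _ _ _ _ inj.
have hs : h \in sites l Y by rewrite mem_sites.
rewrite /sum_le /sum_lt /site_sum (big_rem h hs) [X in _ = X + _](big_rem h hs) /=.
rewrite lexx ltxx add0r addrC; congr (_ + _).
rewrite big_seq_cond [RHS]big_seq_cond; apply: eq_bigl => k.
rewrite mem_rem_uniq ?sites_uniq // inE /= mem_sites.
case: (k =P h) => //= kh; case kY: (k.2 \in Y) => //=; rewrite le_eqVlt.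
by case: eqP => // vk; case: kh; apply: inj; [exact: Yres | left].
Qed.

Lemma sum_lt_second nu y : y \in Y ->
  sum_lt t m Y nu (j, y) = sum_lt t m Y nu (i, y) + site_sgn t nu (i, y).
Proof.
move=> yY; rewrite -(@sum_le_ltE nu (i, y)) //; case: (cr) => _ _ lt _ inj.
rewrite /sum_le /sum_lt /site_sum big_seq_cond [RHS]big_seq_cond.
apply: eq_bigl => h; rewrite mem_sites; case hY: (h.2 \in Y) => //=.
have yh : same_residue (i, y) h by exact: Yres.
have [|np] := boolP (in_pair i j y h).
  case: h {hY yh} => c y0; rewrite /in_pair /= => /andP[/eqP -> /orP[]/eqP ->].
    by rewrite lexx lt.
  by rewrite ltxx leNgt lt.
have [<- _] := crossing_near yh np; rewrite le_eqVlt.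
case: eqP => // vh; have hi : h = (i, y) by apply/esym/inj => //; left.
by move: np; rewrite hi /in_pair !eqxx.
Qed.

(** The heights at which the block of content [y] is entered: its first site is [(i, y)] for [m] and
    [(j, y)] for [m']. *)
Lemma sum_lt_first y : y \in Y ->
  sum_lt t m Y la (i, y) = sum_lt t m' Y la' (j, y).
Proof.
move=> yY; case: (cr) => ij ord lt lt' inj.
have near h hY np := crossing_near (@Yres (i, y) h yY hY) np.
apply: site_sum_agree => //; last by case: lk.
- move=> h hY hi hj; have np : ~~ in_pair i j y h.
    by rewrite /in_pair negb_and negb_or hi hj orbT.
  have [-> _] := near h hY np; apply: ord; first exact: Yres.
  by rewrite /in_pair (negbTE hi) (negbTE hj) !andbF.
move=> y0 y0Y; have [->|ny] := eqVneq y0 y.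
  by rewrite !ltxx !(lt_gtF (lt _)) !(lt_gtF (lt' _)).
have np c : ~~ in_pair i j y (c, y0) by rewrite /in_pair /= (negbTE ny).
have np0 c : ~~ in_pair i j y0 (c, y) by rewrite /in_pair /= eq_sym (negbTE ny).
have near0 c := crossing_near (@Yres (i, y0) (c, y) y0Y yY) (np0 c).
have ord2 c d : (v (c, y0) < v (d, y)) = (v' (c, y0) < v' (d, y)).
  by apply: ord; [exact: Yres | rewrite /in_pair /= (negbTE ny)].
rewrite -!ord2; have [_ <-] := near0 i; have [_ <-] := near0 j.
by have [-> _] := near (i, y0) y0Y (np i).
Qed.

Lemma sum_lt_other h : h.2 \in Y -> h.1 != i -> h.1 != j ->
  sum_lt t m Y la h = sum_lt t m' Y la' h.
Proof.
move=> hY hi hj; case: (cr) => ij ord lt lt' inj.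
have np y : ~~ in_pair i j y h by rewrite /in_pair negb_and negb_or hi hj orbT.
have ordh k : k.2 \in Y -> (v k < v h) = (v' k < v' h).
  move=> kY; apply: ord; first exact: Yres.
  by rewrite /in_pair (negbTE hi) (negbTE hj) !andbF.
apply: site_sum_agree => //; last by case: lk.
  by move=> k kY _ _; exact: ordh.
move=> y yY; have [_ nh] := crossing_near (@Yres (i, y) h yY hY) (np y).
by rewrite -!ordh //= nh.
Qed.

End Sums.
End Order.

(** [M] is the maximal height and [B] the height on entering a block. All heights within the block
    respect the bound [M] exactly when [B] plus the largest prefix sum does, and that sum is the
    same for both words. *)
Lemma sgn_max3 (M B a b a' b' : int) : a + b = a' + b' ->
  Num.max 0 (Num.max a (b + a)) = Num.max 0 (Num.max b' (b' + a')) ->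
  (B < M /\ B + a < M -> B + a < M /\ B + a + b < M ->
    (B < M /\ B + b' < M) /\ (B + b' < M /\ B + b' + a' < M)) /\
  (B <= M /\ B + a <= M -> B + a <= M /\ B + a + b <= M ->
    (B <= M /\ B + b' <= M) /\ (B + b' <= M /\ B + b' + a' <= M)).
Proof. lia. Qed.

Section Transfer.
Variables (i j : 'I_l) (m m' : {ffun 'I_l -> rat}).
Variables (Y : seq int) (z : 'Z_e) (la la' : multipartition l) (g : site l).
Hypotheses (cr : crossing i j m m') (cov : covers t Y z la)
  (cov' : covers t Y z la') (lk : linked_at i j la la')
  (fm : first_max t m Y la g).

Local Notation v := (site_val t m).
Local Notation v' := (site_val t m').

(** [G] isolates the sites to be checked by hand: [g] alone if it lies in a third component, the two
    sites of its block otherwise. Elsewhere the bounds carry over through [sum_lt_other] and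
    [sgn_max3]. *)
Lemma first_max_crossing g' (G : pred (site l)) :
  g'.2 \in Y -> site_sgn t la' g' = 1 ->
  sum_le t m' Y la' g' = sum_le t m Y la g ->
  G g ->
  (forall h, h.2 \in Y -> ~~ G h ->
     (v' h < v' g') = (v h < v g) /\ (v' g' < v' h) = (v g < v h)) ->
  (forall y, G (i, y) = G (j, y)) ->
  (forall h, h.2 \in Y -> G h ->
     (v' h < v' g' -> sum_lt t m' Y la' h < sum_le t m Y la g /\
        sum_lt t m' Y la' h + site_sgn t la' h < sum_le t m Y la g) /\
     (v' g' < v' h -> sum_lt t m' Y la' h <= sum_le t m Y la g /\
        sum_lt t m' Y la' h + site_sgn t la' h <= sum_le t m Y la g)) ->
  first_max t m' Y la' g'.
Proof.
move=> gY' sg' eM Gg out Gij inside.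
have cr' := crossing_sym cr.
have [gY sg _ below above] := fm; have [ij ord lt lt' inj] := cr.
have leE := @sum_le_ltE _ _ _ _ cr Y z la cov la.
have leE' := @sum_le_ltE _ _ _ _ cr' Y z la cov la'.
have [_ Yz _] := cov.
suff all h : h.2 \in Y ->
   (v' h < v' g' -> sum_lt t m' Y la' h < sum_le t m Y la g /\
        sum_lt t m' Y la' h + site_sgn t la' h < sum_le t m Y la g) /\
   (v' g' < v' h -> sum_lt t m' Y la' h <= sum_le t m Y la g /\
        sum_lt t m' Y la' h + site_sgn t la' h <= sum_le t m Y la g).
  split=> //; rewrite ?eM.
  - by rewrite -eM leE' // sg' ltrDl.
  - by move=> h hY hg; rewrite leE' //; apply: (all h hY).1.
  - by move=> h hY hg; rewrite leE' //; apply: (all h hY).2.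
move=> hY; have [/inside|Gh] := boolP (G h); first exact.
have [-> ->] := out h hY Gh.
have [hij|] := boolP ((h.1 == i) || (h.1 == j)); last first.
  rewrite negb_or => /andP[hi hj].
  have -> : site_sgn t la' h = site_sgn t la h by case: lk => off _; rewrite /site_sgn off.
  rewrite -(sum_lt_other cr cov lk hY hi hj) -leE //.
  by split=> hg; [apply: below | apply: above].
case: h hY Gh hij => c y /= yY Gh hij.
have Gi : ~~ G (i, y) by case/orP: hij Gh => /eqP ->; rewrite ?Gij.
have ng : ~~ in_pair i j y g.
  apply: contra Gi; case: (g) Gg => d y0 /= Gg; rewrite /in_pair /=.
  by move=> /andP[/eqP <- /orP[]/eqP di]; move: Gg; rewrite di -?Gij.
have yg : same_residue (i, y) g by rewrite /same_residue /= !Yz.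
have [n1 n2] := crossing_near cr yg ng.
have second := sum_lt_second cr cov la yY.
have second' := sum_lt_second cr' cov la' yY.
have first := sum_lt_first cr cov lk yY.
have [S1 S2] : site_sgn t la (i, y) + site_sgn t la (j, y) =
      site_sgn t la' (i, y) + site_sgn t la' (j, y) /\
   Num.max 0 (Num.max (site_sgn t la (i, y)) (site_sgn t la (j, y) + site_sgn t la (i, y))) =
   Num.max 0 (Num.max (site_sgn t la' (j, y)) (site_sgn t la' (j, y) + site_sgn t la' (i, y))).
  case: lk => _ /(linked_sgn y)[s1 s2]; split=> //.
  by rewrite addrC s1 addrC.
have [lo hi] := sgn_max3 (sum_le t m Y la g) (sum_lt t m Y la (i, y)) S1 S2.
have bi := below (i, y) yY; have bj := below (j, y) yY.
have ai := above (i, y) yY; have aj := above (j, y) yY.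
rewrite (leE (i, y) yY) in bi ai.
rewrite (leE (j, y) yY) second in bj aj.
have both : (v (i, y) < v g -> (sum_lt t m' Y la' (j, y) < sum_le t m Y la g /\
        sum_lt t m' Y la' (j, y) + site_sgn t la' (j, y) < sum_le t m Y la g) /\
     (sum_lt t m' Y la' (i, y) < sum_le t m Y la g /\
        sum_lt t m' Y la' (i, y) + site_sgn t la' (i, y) < sum_le t m Y la g)) /\
   (v g < v (i, y) -> (sum_lt t m' Y la' (j, y) <= sum_le t m Y la g /\
        sum_lt t m' Y la' (j, y) + site_sgn t la' (j, y) <= sum_le t m Y la g) /\
     (sum_lt t m' Y la' (i, y) <= sum_le t m Y la g /\
        sum_lt t m' Y la' (i, y) + site_sgn t la' (i, y) <= sum_le t m Y la g)).
  rewrite second' -first; split=> hg.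
    by apply: lo; [apply: bi | apply: bj; rewrite -n2].
  by apply: hi; [apply: ai | apply: aj; rewrite -n1].
by case/orP: hij => /eqP ->; rewrite -?n1 -?n2; case: both => b1 b2; split=> [/b1|/b2] [].
Qed.

End Transfer.

Variable s : {ffun 'I_l -> int}.
Hypothesis ts : forall c, (t c)%:~R = (s c)%:~R :> 'Z_e.

(** Stated for a relation and not for a map, so that exchanging [i] with [j] and [m] with [m']
    yields the converse. *)
Lemma crystal_crossing i j m m' la la' (z : 'Z_e) mu :
  crossing i j m m' -> linked_at i j la la' -> crystal m s la z mu ->
  exists2 mu', crystal m' s la' z mu' & linked_at i j mu mu'.
Proof.
move=> cr lk cy; have cr' := crossing_sym cr.
have [Y [cov cov']] := covers_exists t z la la'.
have [g fm mv] := crystal_first_max ts cov cy.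
have [ij ord lt lt' inj] := cr; have [_ Yz _] := cov.
have Yres h h' : h.2 \in Y -> h'.2 \in Y -> same_residue h h'.
  by rewrite /same_residue => /Yz -> /Yz ->.
suff [g' fm' lk'] : exists2 g', first_max t m' Y la' g' &
    forall mu', site_moves t la' g' mu' -> linked_at i j mu mu'.
  have [_ sg' _ _ _] := fm'; have [mu' mv'] := site_moves_exists sg'.
  exists mu'; last exact: lk'.
  apply: (first_max_crystal ts cov' _ fm' mv') => h h'.
  by rewrite !mem_sites => hY hY' vv; apply: inj; [exact: Yres | right].
have [gY sg _ below above] := fm; have [offm mvb] := mv; have [off lkd] := lk.
have leE := @sum_le_ltE _ _ _ _ cr Y z la cov la.
have leE' := @sum_le_ltE _ _ _ _ cr' Y z la cov la'.
have [gij|] := boolP ((g.1 == i) || (g.1 == j)); last first.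
  rewrite negb_or => /andP[gi gj].
  have sg' : site_sgn t la' g = 1 by rewrite -sg /site_sgn off.
  exists g.
    apply: (first_max_crossing cr cov lk fm (G := pred1 g)) => //=.
    - by rewrite leE' // leE // sg sg' (sum_lt_other cr cov lk).
    - move=> h hY hg; split; symmetry; apply: ord; try exact: Yres;
        by rewrite /in_pair (negbTE gi) (negbTE gj) !(andbF, andFb).
    - move=> y; case: (g) gi gj => c y0 /= gi gj; rewrite !xpair_eqE.
      by rewrite (eq_sym i) (eq_sym j) (negbTE gi) (negbTE gj).
    - by move=> h hY /eqP ->; rewrite !ltxx.
  move=> mu' [offm' mvb']; split.
    move=> c ci cj; have [->|cg] := eqVneq c g.1; last by rewrite offm // offm' // off.
    apply: (@bead_ext (t g.1)) => x; case: mvb => _ _ ->; case: mvb' => _ _ ->.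
    by rewrite off.
  rewrite !offm ?offm' //; by rewrite eq_sym.
case: g fm mv gY sg below above offm mvb gij
  => c y /= fm mv yY sg below above offm mvb cij.
have second := sum_lt_second cr cov la yY.
have second' := sum_lt_second cr' cov la' yY.
have first := sum_lt_first cr cov lk yY.
have [S1 S2] := linked_sgn y lkd.
(* Comparing the maximum at [g] with the height at the other site of its block bounds the sign
   there. *)
have actc : (c = i /\ [/\ sgn (t i) (la i) y = 1, sgn (t j) (la j) y <= 0,
       mu j = la j & moves_bead (t i) (la i) y (mu i)]) \/
   (c = j /\ [/\ sgn (t j) (la j) y = 1, 0 <= sgn (t i) (la i) y,
       mu i = la i & moves_bead (t j) (la j) y (mu j)]).
  case/orP: cij fm mv sg below above offm mvb => /eqP -> _ _ sg below above offm mvb.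
    left; split=> //; split=> //; last by rewrite offm // eq_sym.
    have [_] := above (j, y) yY (lt y); rewrite !leE //= second sg.
    by rewrite /site_sgn /=; lia.
  right; split=> //; split=> //; last by rewrite offm.
  have [+ _] := below (i, y) yY (lt y); rewrite !leE //= second sg.
  by rewrite /site_sgn /=; lia.
(* The maximum is the entry height plus the largest prefix sum of the block, hence it is reached in
   the same block after the crossing. *)
have eM : sum_le t m Y la (c, y) = sum_lt t m Y la (i, y) +
    Num.max 0 (Num.max (sgn (t i) (la i) y) (sgn (t j) (la j) y + sgn (t i) (la i) y)).
  have := sgn_bound (t i) (la i) y; have := sgn_bound (t j) (la j) y.
  rewrite leE //= sg; case: actc => -[-> [sa sb _ _]].
    rewrite sa; lia.
  by rewrite second /site_sgn /= sa; lia.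
rewrite S2 in eM.
have mu_off d : d != i -> d != j -> mu d = la d.
  by move=> di dj; apply: offm; case/orP: cij => /eqP ->.
have ji : j != i by rewrite eq_sym.
have fin d : (d == i) || (d == j) -> sgn (t d) (la' d) y = 1 ->
    sum_le t m' Y la' (d, y) = sum_le t m Y la (c, y) ->
    (forall h, h = (i, y) \/ h = (j, y) ->
     (site_val t m' h < site_val t m' (d, y) ->
       sum_lt t m' Y la' h < sum_le t m Y la (c, y) /\
       sum_lt t m' Y la' h + site_sgn t la' h < sum_le t m Y la (c, y)) /\
     (site_val t m' (d, y) < site_val t m' h ->
       sum_lt t m' Y la' h <= sum_le t m Y la (c, y) /\
       sum_lt t m' Y la' h + site_sgn t la' h <= sum_le t m Y la (c, y))) ->
    first_max t m' Y la' (d, y).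
  move=> dij sd eqM inside.
  apply: (first_max_crossing cr cov lk fm (G := in_pair i j y)) => //.
  - by rewrite /in_pair /= eqxx.
  - move=> h hY nh.
    have near b : (b == i) || (b == j) ->
        (site_val t m h < site_val t m (b, y)) = (site_val t m h < site_val t m (i, y)) /\
        (site_val t m (b, y) < site_val t m h) = (site_val t m (i, y) < site_val t m h).
      have [n1 n2] := crossing_near cr (@Yres (i, y) h yY hY) nh.
      by case/orP => /eqP ->; rewrite -?n1 -?n2.
    have [d1 d2] := near d dij; have [c1 c2] := near c cij.
    rewrite c1 c2 -d1 -d2; split; symmetry; apply: ord; try exact: Yres.
      by rewrite /= (negbTE nh).
    by apply: contra nh => /andP[/andP[]]; rewrite /in_pair /= => /andP[/eqP ->].
  - by move=> y0; rewrite /in_pair /= !eqxx orbT.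
  move=> [b y0] hY; rewrite /in_pair /= => /andP[/eqP ->].
  by case/orP => /eqP ->; apply: inside; [left|right].
have act : [/\ sgn (t i) (la i) y = 1, sgn (t j) (la j) y <= 0, mu j = la j &
       moves_bead (t i) (la i) y (mu i)] \/
   [/\ sgn (t j) (la j) y = 1, 0 <= sgn (t i) (la i) y, mu i = la i &
       moves_bead (t j) (la j) y (mu j)] by case: actc => -[_]; [left|right].
case: (linked_moves lkd act) => -[sa sb lnk]; [exists (j, y)|exists (i, y)].
- apply: fin => //; first by rewrite eqxx orbT.
    by rewrite eM leE' //= first /site_sgn /= sa; lia.
  move=> h [] ->; rewrite ?ltxx ?(lt_gtF (lt' y)); split=> // _;
    by rewrite second' -first eM /site_sgn /= sa; lia.
- move=> mu' [offm' mvb']; split=> [d di dj|].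
    by rewrite mu_off // -off // offm'.
  by rewrite (offm' i) //; exact: lnk.
- apply: fin => //; first by rewrite eqxx.
    by rewrite eM leE' //= second' first /site_sgn /= sa; lia.
  move=> h [] ->; rewrite ?ltxx ?(lt_gtF (lt' y)); split=> // _;
    by rewrite -first eM /site_sgn /= sa; lia.
- move=> mu' [offm' mvb']; split=> [d di dj|].
    by rewrite mu_off // -off // offm'.
  by rewrite (offm' j) //; exact: lnk.
Qed.

End Crossing.

(** * Walls *)

Section WallCrossing.
Variables (l e : nat) (s : {ffun 'I_l -> int}) (i j : 'I_l) (N : int).
Hypotheses (he : (2 <= e)%N) (ij : i != j).

(* Charges for which the wall crossed becomes [t i - m i = t j - m j]. *)
Definition shifted : {ffun 'I_l -> int} :=
  [ffun c => if c == i then s i - N * e%:Z else s c].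

Lemma shifted_residue c : (shifted c)%:~R = (s c)%:~R :> 'Z_e.
Proof.
rewrite ffunE; case: eqP => [->|//]; rewrite rmorphB rmorphM /=.
by rewrite -[e%:~R]/(e%:R) -[e%:R](Zp_nat_mod he) modnn mulr0 subr0.
Qed.

Lemma same_residueP (h h' : site l) : same_residue e h h' ->
  exists q : int, h.2 = h'.2 + q * e%:Z.
Proof.
move=> hh; have d0 : (h.2 - h'.2)%:~R = 0 :> 'Z_e by rewrite rmorphB /= hh subrr.
have : (e %| absz (h.2 - h'.2)%R)%N.
  have n0 : (absz (h.2 - h'.2)%R)%:R = 0 :> 'Z_e.
    move: d0; case: (h.2 - h'.2)%R => n //=.
    by rewrite NegzE rmorphN /= => /eqP; rewrite oppr_eq0 => /eqP.
  by have := val_Zp_nat he (absz (h.2 - h'.2)%R); rewrite n0 /= => /esym /eqP.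
move=> /dvdnP[k ek]; have [pos|neg] := leP 0 (h.2 - h'.2).
  exists k%:Z; have : `|h.2 - h'.2|%:Z = h.2 - h'.2 by rewrite gez0_abs.
  by rewrite ek PoszM => ->; rewrite addrC subrK.
exists (- k%:Z); have : `|h.2 - h'.2|%:Z = - (h.2 - h'.2) by rewrite ltz0_abs.
by rewrite ek PoszM mulNr => ->; rewrite opprK addrC subrK.
Qed.

(** The walls other than the crossed one are distinguished as sets, so indices must be recovered
    from the set. *)
Lemma wall_inj (c d : 'I_l) (N' : int) : c != d ->
  wall s e c d N' = wall s e i j N ->
  (c = i /\ d = j /\ N' = N) \/ (c = j /\ d = i /\ N' = - N).
Proof.
move=> cd ew.
pose pt (dl : 'I_l -> rat) : {ffun 'I_l -> rat} :=
  [ffun k => (s k)%:~R - (if k == i then (N * e%:Z)%:~R else 0) + dl k].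
have ji : (j == i) = false by rewrite eq_sym (negbTE ij).
have wallE a b n mm : wall s e a b n mm = (wall_form s mm a b = wall_level e n) by [].
have on dl : dl i = dl j -> wall s e c d N' (pt dl).
  move=> dij; rewrite ew wallE /wall_form /wall_level !ffunE eqxx ji dij.
  ring.
have on0 := on (fun=> 0) (erefl _).
(* Otherwise moving coordinate [b] alone would stay on the wall of [i], [j] but leave that of [c],
   [d]. *)
have in_ij b : (b == c) || (b == d) -> (b == i) || (b == j).
  move=> bcd; apply: contraT; rewrite negb_or => /andP[bi bj].
  have := on (fun k => (k == b)%:R); rewrite !(eq_sym _ b) (negbTE bi) (negbTE bj).
  move=> /(_ (erefl _)); move: on0; rewrite !wallE => <-; rewrite /wall_form !ffunE.
  by case/orP: bcd => /eqP ->; rewrite eqxx ?(eq_sym d c) (negbTE cd) /=; clear; lra.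
have e0 : e%:Z != 0 by lia.
have cij := in_ij c; have dij := in_ij d; rewrite !eqxx orbT in cij dij.
move: on0; rewrite wallE /wall_form /wall_level !ffunE.
case/orP: (cij isT) => /eqP cE; case/orP: (dij isT) => /eqP dE; rewrite cE dE ?eqxx ?ji;
  try by rewrite cE dE eqxx in cd.
- move=> h; left; split=> //; split=> //; apply: (mulIf e0).
  by apply/eqP; rewrite -(eqr_int rat); apply/eqP; rewrite -h; ring.
- move=> h; right; split=> //; split=> //; apply: (mulIf e0).
  by apply/eqP; rewrite -(eqr_int rat); apply/eqP; rewrite -h mulNr rmorphN /=; ring.
Qed.

(** Ordering two sites of equal residue in different components means deciding on which side of a
    wall [m] lies. Its level is [q] corrected by the shift of component [i]. *)
Lemma site_val_wall m (c d : 'I_l) (y q : int) :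
  let N' := q + (if c == i then N else 0) - (if d == i then N else 0) in
  site_val shifted m (d, y) - site_val shifted m (c, y + q * e%:Z) =
  wall_form s m c d - wall_level e N'.
Proof.
rewrite /site_val /wall_form /wall_level /= !ffunE.
case: (c =P i) => [->|_]; case: (d =P i) => [->|_];
  rewrite ?(rmorphB, rmorphD, rmorphM) /=; ring.
Qed.

Lemma walls_crossing (m m' : {ffun 'I_l -> rat})
    (hm : ~ walls s e m) (hm' : ~ walls s e m')
    (hother : forall (i' j' : 'I_l) (N' : int), i' != j' ->
       wall s e i' j' N' <> wall s e i j N ->
       ~ separated_by s e i' j' N' m m')
    (hside : (N * e%:Z)%:~R < (s i)%:~R - m i - ((s j)%:~R - m j))
    (hside' : (s i)%:~R - m' i - ((s j)%:~R - m' j) < (N * e%:Z)%:~R) :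
  crossing e shifted i j m m'.
Proof.
have ji : (j == i) = false by rewrite eq_sym (negbTE ij).
have same_comp (mm : {ffun 'I_l -> rat}) c (y y' : int) :
    (site_val shifted mm (c, y) < site_val shifted mm (c, y')) = (y < y').
  by rewrite /site_val /= ltrD2r ltr_int ltrD2r.
have at_pair (mm : {ffun 'I_l -> rat}) (y : int) :
    site_val shifted mm (j, y) - site_val shifted mm (i, y) =
    wall_form s mm i j - wall_level e N.
  by have := site_val_wall mm i j y 0; rewrite eqxx ji mul0r addr0 add0r subr0.
split=> //.
- move=> [c y] [d y'] hh np; have [/= q ey] := same_residueP hh; rewrite {}ey in hh np *.
  have [cd|cd] := eqVneq c d; first by rewrite cd !same_comp.
  have dist (mm : {ffun 'I_l -> rat}) := site_val_wall mm c d y' q.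
  set N' := (_ - _) in dist.
  (* Were this the crossed wall, [q] would be 0 and the two sites would form the exchanged pair,
     which [np] excludes. *)
  have nw : wall s e c d N' <> wall s e i j N.
    move=> /(wall_inj cd) cases; case/negP: np; rewrite /in_pair /=.
    have ty : y' + q * e%:Z = y'.
      suff -> : q = 0 by rewrite mul0r addr0.
      by case: cases => [[ci [dj]]|[cj [di]]]; rewrite /N' ?ci ?dj ?cj ?di eqxx ji; lia.
    rewrite ty eqxx; case: cases => [[-> [-> _]]|[-> [-> _]]];
      by rewrite !eqxx ?orbT //= ?ij // ji.
  have nsep := hother c d N' cd nw.
  have off (mm : {ffun 'I_l -> rat}) : ~ walls s e mm -> wall_form s mm c d <> wall_level e N'.
    by move=> nmm ew; apply: nmm; exists c, d, N'.
  have lt_wall (mm : {ffun 'I_l -> rat}) :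
     (site_val shifted mm (c, y' + q * e%:Z) < site_val shifted mm (d, y')) =
     (wall_level e N' < wall_form s mm c d).
    by rewrite -subr_gt0 dist subr_gt0.
  rewrite !lt_wall; have W := off m hm; have W' := off m' hm'.
  have [a|a|/esym //] := ltgtP (wall_level e N') (wall_form s m c d);
  have [b|b|/esym //] := ltgtP (wall_level e N') (wall_form s m' c d) => //;
  by exfalso; apply: nsep; rewrite /separated_by a b; constructor.
- move=> y; rewrite -subr_gt0 at_pair subr_gt0; exact: hside.
- move=> y; rewrite -subr_lt0 at_pair subr_lt0; exact: hside'.
move=> [c y] [d y'] hh vv; have [/= q ey] := same_residueP hh; rewrite {}ey in hh vv *.
have [cd|cd] := eqVneq c d.
  have yy (mm : {ffun 'I_l -> rat}) : site_val shifted mm (c, y' + q * e%:Z) =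
      site_val shifted mm (c, y') -> y' + q * e%:Z = y'.
    move=> ev; have := same_comp mm c (y' + q * e%:Z) y'.
    have := same_comp mm c y' (y' + q * e%:Z).
    by rewrite ev ltxx; case: ltgtP.
  by rewrite -cd in vv *; case: vv => /yy ->.
have on_wall (mm : {ffun 'I_l -> rat}) :
    site_val shifted mm (c, y' + q * e%:Z) = site_val shifted mm (d, y') ->
    walls s e mm.
  move=> vmm; have := site_val_wall mm c d y' q; rewrite vmm subrr /= => /esym/eqP.
  rewrite subr_eq0 => /eqP w; exists c, d; eexists; split; [exact: cd | exact: w].
by case: vv => /on_wall.
Qed.

End WallCrossing.

(** * The crystal isomorphism *)

Lemma crystal_isomorphism_crossing (l e : nat) (s t : {ffun 'I_l -> int})
    (i j : 'I_l) (m m' : {ffun 'I_l -> rat}) (Psi : multipartition l -> multipartition l) :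
  (forall c, (t c)%:~R = (s c)%:~R :> 'Z_e) -> crossing e t i j m m' ->
  bijective Psi -> (forall la, linked_at t i j la (Psi la)) ->
  crystal_isomorphism (@crystal l e m s) (@crystal l e m' s) Psi.
Proof.
move=> ts cr bij lkP; have ij : i != j by case: cr.
have ji : j != i by rewrite eq_sym.
have uniqR la mu mu' : linked_at t i j la mu -> linked_at t i j la mu' -> mu = mu'.
  move=> [off lk] [off' lk']; have [ej ei] := linked_uniq lk lk'.
  apply/ffunP => c; have [->|ci] := eqVneq c i; first exact: ei.
  by have [->|cj] := eqVneq c j; [exact: ej | rewrite off ?off'].
have flip la mu : linked_at t i j la mu -> linked_at t j i mu la.
  by move=> [off /linked_flip lk]; split=> // c cj ci; rewrite off.
have uniqL la la' mu : linked_at t i j la mu -> linked_at t i j la' mu -> la = la'.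
  move=> /flip[off lk] /flip[off' lk']; have [ei ej] := linked_uniq lk lk'.
  apply/ffunP => c; have [->|ci] := eqVneq c i; first exact: ei.
  by have [->|cj] := eqVneq c j; [exact: ej | rewrite off ?off'].
have arrow la (z : 'Z_e) mu :
    crystal m s la z mu <-> crystal m' s (Psi la) z (Psi mu).
  split=> cy0.
    have [mu' cy lk] := crystal_crossing ts cr (lkP la) cy0.
    by rewrite (uniqR _ _ _ (lkP mu) lk).
  (* The opposite crossing carries the arrow back; uniqueness of links identifies its target with
     [mu]. *)
  have [mu' cy lk] :=
    crystal_crossing ts (crossing_sym cr) (flip _ _ (lkP la)) cy0.
  rewrite (uniqL mu mu' _ (lkP mu)) //; case: lk => off /linked_flip lk'.
  by split=> // c ci cj; rewrite off.
split=> //.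
- move=> la; have [off lk] := lkP la.
  rewrite /rank (bigD1 i) //= (bigD1 j) //= [RHS](bigD1 i) //=.
  rewrite [X in _ = (_ + X)%N](bigD1 j) //=.
  have <- : (\sum_(c < l | (c != i) && (c != j)) sumn (la c) =
           \sum_(c < l | (c != i) && (c != j)) sumn (Psi la c))%N.
    by apply: eq_bigr => c /andP[ci cj]; rewrite off.
  by rewrite !addnA; congr (_ + _)%N; rewrite addnC -(linked_sumn lk) addnC.
- move=> la; split=> hw z mu.
    have [inv invK Kinv] := bij; rewrite -[mu]Kinv => /arrow; exact: hw.
  by move/arrow; exact: hw.
Qed.

Theorem theorem3p7 (l e : nat) (hl : (2 <= l)%N) (he : (2 <= e)%N)
    (s : {ffun 'I_l -> int}) (i j : 'I_l) (hij : i != j) (N : int)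
    (m m' : {ffun 'I_l -> rat})
    (hm : ~ walls s e m) (hm' : ~ walls s e m')
    (hother : forall (i' j' : 'I_l) (N' : int), i' != j' ->
       wall s e i' j' N' <> wall s e i j N ->
       ~ separated_by s e i' j' N' m m')
    (hside : (N * e%:Z)%:~R < (s i)%:~R - m i - ((s j)%:~R - m j))
    (hside' : (s i)%:~R - m' i - ((s j)%:~R - m' j) < (N * e%:Z)%:~R) :
  crystal_isomorphism (@crystal l e m s) (@crystal l e m' s)
    (@wall_crossing l e s i j N).
Proof.
pose t := shifted e s i N.
have ti : t i = s i - N * e%:Z by rewrite ffunE eqxx.
have ji : (j == i) = false by rewrite eq_sym (negbTE hij).
have tj : t j = s j by rewrite ffunE ji.
apply: (crystal_isomorphism_crossing (t := t) (i := i) (j := j)).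
- exact: shifted_residue.
- exact: walls_crossing.
- exists (fun la : multipartition l => [ffun k =>
    let nu := Phi (s i - N * e%:Z) (s j) (la i, la j) in
    if k == i then nu.1 else if k == j then nu.2 else la k]) => la;
  apply/ffunP => k; rewrite /wall_crossing !ffunE eqxx ji eqxx -surjective_pairing
    ?Phi_invK ?PhiKV; do 2?[case: eqP => [->|_] //=].
move=> la; split=> [c ci cj|].
  by rewrite /wall_crossing ffunE (negbTE ci) (negbTE cj).
(* After the flip the old pair [(la i, la j)] has to be linked from the new one, whose image under
   [Phi] it is. *)
rewrite ti tj /wall_crossing !ffunE eqxx ji eqxx; apply: linked_flip.
rewrite -surjective_pairing -[X in linked _ _ _ X](Phi_invK (s i - N * e%:Z) (s j)).
exact: Phi_linked.
Qed.
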